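(* Let $m\in\mathbb{N}$. Let $\Omega=(\Omega^i_j)_{1\le i,j\le m}\in L^2(B^n,so(m)\otimes\wedge^1\mathbb{R}^n)$, and let $A\in L^\infty(B^n,M_m(\mathbb{R}))\cap W^{1,2}$ and $B\in W^{1,2}(B^n,M_m(\mathbb{R})\otimes\wedge^2\mathbb{R}^n)$ satisfy $$d_\Omega A:=dA-A\Omega=-d^*B,$$ i.e. $dA^i_j-\sum_{k=1}^mA^i_k\Omega^k_j=-d^*B^i_j$ for all $i,j\in\{1,\dots,m\}$. Then every solution $u\in W^{1,2}(B^n,\mathbb{R}^m)$ of $$-\Delta u^i=\sum_{j=1}^m\Omega^i_j\cdot\nabla u^j\quad\text{on }B^n,\qquad i=1,\dots,m,$$ satisfies the conservation law $$d\left( *A\,du+(-1)^{n-1}( *B)\wedge du\right)=0 .$$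
   Context: $B^n$ is the unit ball of $\mathbb{R}^n$, and $M_m(\mathbb{R})$ is the space of real $m\times m$ matrices. $\Omega\in L^2(B^n,so(m)\otimes\wedge^1\mathbb{R}^n)$ means that $\Omega$ is an $L^2$ matrix of $1$-forms with $\Omega^i_j=-\Omega^j_i$. The expression $\Omega^i_j\cdot\nabla u^j$ is the pointwise scalar product of the $1$-forms $\Omega^i_j$ and $du^j$. $*$ is the Hodge star operator of $\mathbb{R}^n$ and $d^*$ is the formal $L^2$-adjoint of $d$. The $i$-th component of $*A\,du+(-1)^{n-1}( *B)\wedge du$ is $\sum_j\left[A^i_j\,{*du^j}+(-1)^{n-1}( *B^i_j)\wedge du^j\right]$. All equations are understood in the sense of distributions. *)

(* Defs.v *)
From HB Require Import structures.
From mathcomp Require Import all_boot all_order all_algebra.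
From mathcomp Require Import all_classical all_reals all_analysis.

Set Implicit Arguments.
Unset Strict Implicit.
Unset Printing Implicit Defensive.

Import Order.TTheory GRing.Theory Num.Theory.
Import numFieldNormedType.Exports.

Local Open Scope classical_set_scope.
Local Open Scope ring_scope.

(* The product sigma-algebra on R^n, as for [n.-tuple] in the library. *)
Section measurable_rV.
Context {d} {T : sigmaRingType d} (n : nat).

Let coors : 'I_n -> 'rV[T]_n -> T := fun i x => x ord0 i.

Let rV_set0 : g_sigma_preimage coors set0.
Proof. exact: sigma_algebra0. Qed.

Let rV_setC A : g_sigma_preimage coors A -> g_sigma_preimage coors (~` A).
Proof. exact: sigma_algebraC. Qed.

Let rV_bigcup (F : _^nat) : (forall i, g_sigma_preimage coors (F i)) ->
  g_sigma_preimage coors (\bigcup_i (F i)).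
Proof. exact: sigma_algebra_bigcup. Qed.

HB.instance Definition _ := @isMeasurable.Build (measure_tuple_display d)
  'rV[T]_n (g_sigma_preimage coors) rV_set0 rV_setC rV_bigcup.

End measurable_rV.

Section measurable_rV_lemmas.
Context {d d'} {T : measurableType d} {T' : measurableType d'}.

Lemma measurable_coord n (i : 'I_n) :
  measurable_fun [set: 'rV[T]_n] (fun x : 'rV[T]_n => x ord0 i).
Proof.
move=> _ Y mY; rewrite setTI; apply: sub_sigma_algebra => /=.
rewrite -bigcup_seq/=; exists i => /=; first by rewrite mem_index_enum.
by exists Y => //; rewrite setTI.
Qed.

Lemma measurable_fun_rV n (f : T' -> 'rV[T]_n) :
  (forall i, measurable_fun [set: T'] (fun x => f x ord0 i)) ->
  measurable_fun [set: T'] f.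
Proof.
move=> mf; apply: (@measurability _ _ _ _ setT f _ erefl) => // _ [B + <-].
rewrite -bigcup_seq/= => -[i _ [A mA <-]].
rewrite setTI setTI -comp_preimage -[_ @^-1` _]setTI.
exact: mf.
Qed.

End measurable_rV_lemmas.

Section lebesgue_rV.
Context {R : realType}.

Definition rVcons n (p : measurableTypeR R * 'rV[R]_n) : 'rV[R]_n.+1 :=
  \row_i oapp (p.2 ord0) p.1 (unlift ord0 i).

Lemma measurable_rVcons n : measurable_fun setT (@rVcons n).
Proof.
apply: measurable_fun_rV => i; case: (unliftP ord0 i) => [j ->|->].
  rewrite (_ : (fun _ => _) =
      (fun v : 'rV[R]_n => v ord0 j) \o (@snd (measurableTypeR R) _)); last first.
    by apply/funext => p; rewrite mxE liftK.
  exact: (measurableT_comp (measurable_coord j) measurable_snd).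
rewrite (_ : (fun _ => _) = @fst (measurableTypeR R) 'rV[R]_n); last first.
  by apply/funext => p; rewrite mxE unlift_none.
exact: measurable_fst.
Qed.

Definition rVuncons n (v : 'rV[R]_n.+1) : measurableTypeR R * 'rV[R]_n :=
  (v ord0 ord0, \row_j v ord0 (lift ord0 j)).

Lemma rVconsK n : cancel (@rVcons n) (@rVuncons n).
Proof.
move=> [x v]; rewrite /rVuncons mxE unlift_none /=; congr pair.
by apply/rowP => j; rewrite !mxE liftK.
Qed.

Lemma measurable_rVuncons n : measurable_fun setT (@rVuncons n).
Proof.
apply/measurable_fun_pairP; split; first exact: measurable_coord.
apply: measurable_fun_rV => i.
rewrite (_ : (fun _ => _) = (fun v : 'rV[R]_n.+1 => v ord0 (lift ord0 i))).
  exact: measurable_coord.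
by apply/funext => v; rewrite /= mxE.
Qed.

Section step.
Variables (n : nat) (mu : {sigma_finite_measure set 'rV[R]_n -> \bar R}).

Definition lebesgue_step : set 'rV[R]_n.+1 -> \bar R :=
  pushforward (lebesgue_measure \x mu)%E (@rVcons n).

Let step0 : lebesgue_step set0 = 0%E.
Proof. by rewrite /lebesgue_step /pushforward preimage_set0 measure0. Qed.

Let step_ge0 A : (0 <= lebesgue_step A)%E.
Proof. by rewrite /lebesgue_step /pushforward; exact: measure_ge0. Qed.

Let step_sigma_additive : semi_sigma_additive lebesgue_step.
Proof.
have mcons A : measurable A -> measurable (@rVcons n @^-1` A).
  by move=> mA; rewrite -[X in measurable X]setTI; exact: measurable_rVcons.
move=> F mF tF mUF; rewrite /lebesgue_step /pushforward preimage_bigcup.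
apply: measure_semi_sigma_additive.
- by move=> k; exact: mcons.
- apply/trivIsetP => /= i j _ _ ij; rewrite -preimage_setI.
  by move/trivIsetP : tF => /(_ _ _ _ _ ij) ->//; rewrite preimage_set0.
- by rewrite -preimage_bigcup; exact: mcons.
Qed.

HB.instance Definition _ := isMeasure.Build _ _ _ lebesgue_step
  step0 step_ge0 step_sigma_additive.

Lemma lebesgue_stepX (A : set (measurableTypeR R)) (B : set 'rV[R]_n) :
  measurable A -> measurable B ->
  lebesgue_step (@rVuncons n @^-1` (A `*` B)) = (lebesgue_measure A * mu B)%E.
Proof.
move=> mA mB; rewrite -product_measure1E// /lebesgue_step /pushforward.
by rewrite -comp_preimage (_ : _ \o _ = id)//; apply/funext => x; exact: rVconsK.
Qed.

Let step_sigma_finite : sigma_finite setT lebesgue_step.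
Proof.
have /sigma_finiteP[F [TF ndF Foo]] := sigma_finiteT (@lebesgue_measure R).
have /sigma_finiteP[G [TG ndG Goo]] := sigma_finiteT mu.
exists (fun k => @rVuncons n @^-1` (F k `*` G k)).
  rewrite -preimage_bigcup; apply/seteqP; split => // v _.
  have [i _ Fi] : (\bigcup_i F i) (rVuncons v).1 by rewrite -TF.
  have [j _ Gj] : (\bigcup_i G i) (rVuncons v).2 by rewrite -TG.
  exists (maxn i j) => //; split.
  - by move: Fi; exact/subsetPset/ndF/leq_maxl.
  - by move: Gj; exact/subsetPset/ndG/leq_maxr.
move=> k; have [mFk Fk] := Foo k; have [mGk Gk] := Goo k; split.
  rewrite -[X in measurable X]setTI; apply: measurable_rVuncons => //.
  exact: measurableX.
by rewrite lebesgue_stepX// lte_mul_pinfty// ge0_fin_numE.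
Qed.

HB.instance Definition _ := Measure_isSigmaFinite.Build _ _ _ lebesgue_step
  step_sigma_finite.

End step.

(* Lebesgue measure on R^n. *)
Fixpoint lebesgue_rV n : {sigma_finite_measure set 'rV[R]_n -> \bar R} :=
  if n is n'.+1 then lebesgue_step (lebesgue_rV n')
  else (\d_(0 : 'rV[R]_0) : {measure set 'rV[R]_0 -> \bar R}).

Lemma lebesgue_rV_box n (a b : 'rV[R]_n) : (forall i, a ord0 i <= b ord0 i) ->
  lebesgue_rV n [set x | forall i, x ord0 i \in `]a ord0 i, b ord0 i]] =
  (\prod_i (b ord0 i - a ord0 i))%:E.
Proof.
elim: n a b => [|n IH] a b ab.
  rewrite big_ord0 /= diracE mem_set//.
  by case.
pose c v : 'rV[R]_n := (@rVuncons n v).2.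
have cE v i : c v ord0 i = v ord0 (lift ord0 i) by rewrite mxE.
pose box : set 'rV[R]_n :=
  [set x | forall i, x ord0 i \in `]c a ord0 i, c b ord0 i]].
have mbox : measurable box.
  rewrite (_ : box = \bigcap_(i in [set: 'I_n])
      (fun x : 'rV[R]_n => x ord0 i) @^-1` `]c a ord0 i, c b ord0 i]%classic).
    apply: fin_bigcap_measurable => // i _.
    by rewrite -[X in measurable X]setTI; exact: measurable_coord.
  by apply/seteqP; split => [x bx i _|x bx i]; exact: bx.
rewrite [X in lebesgue_rV _ X](_ : _ =
  @rVuncons n @^-1` (`]a ord0 ord0, b ord0 ord0]%classic `*` box)).
  transitivity (lebesgue_measure `]a ord0 ord0, b ord0 ord0]%classic *
                lebesgue_rV n box)%E; first exact: lebesgue_stepX.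
  rewrite big_ord_recl IH => [|i]; last by rewrite !cE.
  rewrite lebesgue_measure_itv/= lte_fin EFinM; congr (_ * _)%E.
    have [//|ba] := ltP.
    by rewrite (_ : a ord0 ord0 = b ord0 ord0) ?subrr//; apply/le_anti/andP.
  by congr EFin; apply: eq_bigr => i _; rewrite !cE.
apply/seteqP; split => [x bx|x [/= b0 bx] i].
  by split => //= i; rewrite -/(c x) !cE; exact: bx.
case: (unliftP ord0 i) => [j ->|->//].
by have := bx j; rewrite -/(c x) !cE.
Qed.

End lebesgue_rV.

(* The exterior algebra of R^n, in all degrees at once: [a I] is the coefficient
   of the basis element dx_I, the wedge of the dx_i, i \in I, in increasing order
   of indices. *)
Notation extalg R n := {ffun {set 'I_n} -> R^o}.

Section exterior_algebra.
Context {R : comNzRingType} {n : nat}.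
Implicit Types (I J K : {set 'I_n}) (a b : extalg R n).

(* dx_I /\ dx_J = shuffle_sign I J *: dx_(I :|: J) for disjoint I and J. *)
Definition shuffle_sign I J : R :=
  (-1) ^+ #|[pred p : 'I_n * 'I_n | [&& p.1 \in I, p.2 \in J & (p.2 < p.1)%N]]|.

Definition wedge a b : extalg R n :=
  [ffun K : {set 'I_n} => \sum_(I : {set 'I_n} | I \subset K)
     shuffle_sign I (K :\: I) * a I * b (K :\: I)].

(* *dx_I = shuffle_sign I (~: I) *: dx_(~: I), so that dx_I /\ *dx_I = vol. *)
Definition hodge a : extalg R n :=
  [ffun K : {set 'I_n} => shuffle_sign (~: K) K * a (~: K)].

Definition dot a b : R := \sum_I a I * b I.

Definition dx (i : 'I_n) : extalg R n :=
  [ffun I : {set 'I_n} => (I == [set i]%SET)%:R].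

Definition form0 (c : R) : extalg R n :=
  [ffun I : {set 'I_n} => if #|I| == 0%N then c else 0].

Definition homogeneous (k : nat) a : Prop := forall I, #|I| != k -> a I = 0.

(* [hodge (form0 1)] is the volume form. *)
Lemma wedge_hodge k a b : homogeneous k a -> homogeneous k b ->
  wedge a (hodge b) = dot a b *: hodge (form0 1).
Proof.
move=> ha hb; apply/ffunP => K; rewrite !ffunE cards_eq0.
have sgn2 I J : shuffle_sign I J * shuffle_sign I J = 1.
  by rewrite -expr2 sqrr_sign.
have [KT|KT] := eqVneq (~: K) finset.set0.
  have -> : K = finset.setT by rewrite -[K]finset.setCK KT finset.setC0.
  rewrite (_ : shuffle_sign _ _ = 1); last first.
    rewrite /shuffle_sign eq_card0// => p; rewrite !inE //.
  rewrite [1 * 1]mulr1 -[_ *: _]/(dot a b * 1) mulr1 /dot.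

  rewrite (eq_bigl predT) => [|I]; last by rewrite finset.subsetT.
  apply: eq_bigr => I _; rewrite ffunE finset.setTD finset.setCK.
  by rewrite mulrACA sgn2 mul1r.
rewrite mulr0 scaler0; apply: big1 => I IK; rewrite ffunE.
have [Ik|/ha->] := eqVneq #|I| k; last by rewrite mulr0 mul0r.
rewrite hb ?mulr0// -Ik; apply: contraNneq KT => cardI.
have : #|~: K| == 0%N.
  rewrite -(eqn_add2l #|I|) addn0 -[X in _ == X]cardI finset.setCD.
  rewrite finset.setUC cardsU (_ : I :&: ~: K = finset.set0) ?cards0 ?subn0//.
  by apply/eqP; rewrite -finset.setDE finset.setD_eq0.
by rewrite cards_eq0.
Qed.

End exterior_algebra.

Section differentiation.
Context {R : realType} {n : nat}.
Implicit Types (f g phi : 'rV[R]_n -> R) (omega psi : 'rV[R]_n -> extalg R n).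

Definition partial (i : 'I_n) f : 'rV[R]_n -> R := fun x => 'D_('e_i) f x.

Definition partials (s : seq 'I_n) f : 'rV[R]_n -> R := foldr partial f s.

Definition smooth f : Prop := forall s : seq 'I_n,
  continuous (partials s f) /\ forall i x, derivable (partials s f) x 'e_i.

Definition laplacian f : 'rV[R]_n -> R := fun x => \sum_i partial i (partial i f) x.

Definition form_partial (i : 'I_n) psi : 'rV[R]_n -> extalg R n :=
  fun x => [ffun I : {set 'I_n} => partial i (fun y => psi y I) x].

Definition extd psi : 'rV[R]_n -> extalg R n :=
  fun x => \sum_i wedge (dx i) (form_partial i psi x).

End differentiation.

Section ball.
Context {R : realType} {n : nat}.
Implicit Types (f g phi : 'rV[R]_n -> R) (omega psi : 'rV[R]_n -> extalg R n).

Definition unit_ball : set 'rV[R]_n := [set x | \sum_i x ord0 i ^+ 2 < 1].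

(* Functions and forms on the ball are given by functions on R^n whose values
   outside the ball are ignored. *)
Definition ball_integral f : R := \int[lebesgue_rV n]_(x in unit_ball) f x.

Definition in_L2 f : Prop := (f \_ unit_ball) \in Lfun (lebesgue_rV n) 2%:E.

Definition in_Linfty f : Prop := (f \_ unit_ball) \in Lfun (lebesgue_rV n) +oo%E.

Definition test_function phi : Prop :=
  [/\ smooth phi, compact (closure [set x | phi x != 0]) &
      closure [set x | phi x != 0] `<=` unit_ball].

Definition is_weak_partial i f g : Prop := forall phi, test_function phi ->
  ball_integral (fun x => f x * partial i phi x) =
  - ball_integral (fun x => g x * phi x).

Definition in_W12 f : Prop :=
  in_L2 f /\ forall i, exists g, in_L2 g /\ is_weak_partial i f g.

(* Defined up to a null set, and only when the weak derivative exists in L^2. *)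
Definition weak_partial i f : 'rV[R]_n -> R :=
  xget (fun=> 0) [set g | in_L2 g /\ is_weak_partial i f g].

Definition weak_differential f : 'rV[R]_n -> extalg R n :=
  fun x => \sum_i weak_partial i f x *: dx i.

Definition kform_on_ball (k : nat) omega : Prop :=
  forall x, unit_ball x -> homogeneous k (omega x).

Definition in_L2_form (k : nat) omega : Prop :=
  kform_on_ball k omega /\ forall I, in_L2 (fun x => omega x I).

Definition in_W12_form (k : nat) omega : Prop :=
  kform_on_ball k omega /\ forall I, in_W12 (fun x => omega x I).

Definition test_form psi : Prop := forall I, test_function (fun x => psi x I).

(* Form-valued distributions are functionals on test forms, a locally
   integrable form acting by the L^2 pairing. *)
Definition distr omega psi : R := ball_integral (fun x => dot (omega x) (psi x)).

(* d = \sum_i dx_i /\ D_i, with the partial derivatives D_i moved to the test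
   form. *)
Definition distr_d omega psi : R :=
  - \sum_i ball_integral
      (fun x => dot (wedge (dx i) (omega x)) (form_partial i psi x)).

(* d^* is the formal L^2-adjoint of d: <d^* omega, psi> = <omega, d psi>. *)
Definition distr_dstar omega psi : R := distr omega (extd psi).

Definition distr_laplacian f phi : R :=
  ball_integral (fun x => f x * laplacian phi x).

End ball.

(* Main.v *)
(* Let v = kappa * du^j be a mollification of the weak gradient of u^j and eta a test
   function, and test the equation for dA^i_j - sum_k A^i_k Omega^k_j against the 1-form
   eta v. On the support of eta the derivative of v is symmetric, so B^i_j, being
   antisymmetric, only meets d eta /\ v, and the divergence of v is -(kappa * f), where
   f = sum_k Omega^j_k . du^k. This is the conservation law for the mollified u^j, up to
   the terms A^i_j (kappa * f) - (sum_k A^i_k Omega^k_j) . v. By Fubini it says that the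
   average, against a small bump in z, of the same integral with the u-factors translated
   by z vanishes. That integral is continuous at z = 0, since translations are continuous
   in L^1, hence it vanishes at z = 0; in the sum over j the extra terms cancel. *)

(* The equation for A may be tested only against smooth forms, while eta du is merely L2; this
   forces the mollification. Only u is mollified: A, B and Omega stay as they are, so no commutator
   of a product with a mollifier has to be estimated. What remains is a limit in products of a fixed
   factor with a translated one. Two kinds occur: a bounded function against f, which is only L1,
   and two L2 functions. Continuity of translations in L1 serves for both, for the second after a
   truncation.

   No approximate identity of integral one is built. If the average of the flux against a
   nonnegative weight vanishes, the flux is nonpositive at some point where the weight is positive.
   Bumps shrinking to the origin then give a nonpositive value at 0, and the same argument for the
   opposite flux gives equality. Hence any nonnegative bump will do, and the square of a rescaled
   eta is one.

   The law is an identity between n-forms, so the only coefficient of the test form that matters is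
   that of the volume form; this coefficient is eta. *)
From HB Require Import structures.
Require Import Defs.
From mathcomp Require Import all_boot all_order all_algebra.
From mathcomp Require Import ring lra.

Import Order.TTheory GRing.Theory Num.Theory.

Set Implicit Arguments.
Unset Strict Implicit.
Unset Printing Implicit Defensive.

Local Open Scope ring_scope.

(** * Exterior algebra *)

Section exterior_algebra_lemmas.
Context {R : comNzRingType} {n : nat}.
Implicit Types (I J K : {set 'I_n}) (a b w : extalg R n) (i j l : 'I_n).
Local Open Scope set_scope.

Let scale_regularE (c x : R) : c *: (x : R^o) = c * x. Proof. by []. Qed.

(** The sign that reorders dx_i /\ dx_j. The value 1 on the diagonal is a convention: it makes every
    value its own inverse. *)
Definition transpose_sign i j : R := if (j < i)%N then -1 else 1.

(** As a product over pairs, the sign splits along unions of index sets, which a count of inversions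
    does only awkwardly. *)
Lemma shuffle_sign_prod I J :
  shuffle_sign I J = \prod_(i in I) \prod_(j in J) transpose_sign i j :> R.
Proof.
rewrite pair_big /= /shuffle_sign -prodr_const big_mkcond [RHS]big_mkcond.
apply: eq_bigr => -[i j] _; rewrite !inE /= /transpose_sign.
by case: (i \in I); case: (j \in J).
Qed.

Lemma transpose_sign_sqr i j : transpose_sign i j * transpose_sign i j = 1.
Proof. by rewrite /transpose_sign; case: ifP; rewrite ?mulrNN mulr1. Qed.

Lemma transpose_signC i j : i != j -> transpose_sign i j = - transpose_sign j i.
Proof.
rewrite -val_eqE /= neq_ltn /transpose_sign => /orP[] ij; rewrite ij ltnNge (ltnW ij) //=.
by rewrite opprK.
Qed.

Lemma shuffle_sign1 i j : shuffle_sign [set i] [set j] = transpose_sign i j.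
Proof. by rewrite shuffle_sign_prod !big_set1. Qed.

Lemma wedge_dxl i w K :
  wedge (dx i) w K =
    (if i \in K then shuffle_sign [set i] (K :\ i) * (w (K :\ i) : R) else 0) :> R.
Proof.
rewrite ffunE; case: ifPn => iK.
  have si : [set i] \subset K by rewrite sub1set.
  rewrite (bigD1 [set i] si) /= big1 ?addr0; last first.
    by move=> I /andP[_ /negPf Ii]; rewrite ffunE Ii mulr0 mul0r.
  by rewrite ffunE eqxx mulr1.
rewrite big1 // => I IK; rewrite ffunE.
by case: eqP => [Ii|_]; [rewrite Ii sub1set (negPf iK) in IK|rewrite mulr0 mul0r].
Qed.

Lemma wedge_dxr w l J :
  wedge w (dx l) J =
    (if l \in J then shuffle_sign (J :\ l) [set l] * (w (J :\ l) : R) else 0) :> R.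
Proof.
rewrite ffunE; have DD I : I \subset J -> (J :\: I == [set l]) = (l \in J) && (I == J :\ l).
  move=> IJ; apply/eqP/andP => [E|[lJ /eqP ->]].
    split; first by rewrite -sub1set -E subsetDl.
    by rewrite -E setDDr setDv set0U (setIidPr IJ).
  by rewrite setDDr setDv set0U; apply/setIidPr; rewrite sub1set.
case: ifPn => lJ.
  rewrite (bigD1 (J :\ l) (subD1set _ _)) /= big1 ?addr0; last first.
    by move=> I /andP[IJ /negPf Ii]; rewrite ffunE DD // Ii andbF mulr0.
  have -> : J :\: (J :\ l) = [set l] by apply/eqP; rewrite DD ?subD1set // lJ eqxx.
  by rewrite ffunE eqxx mulr1.
by rewrite big1 // => I IJ; rewrite ffunE DD // (negPf lJ) mulr0.
Qed.

(** With an arbitrary index sequence, additivity and homogeneity become the instances over [bool]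
    and [unit]. *)
Lemma wedge_sumr (T : Type) (s : seq T) (c : T -> R) (f : T -> extalg R n) a :
  wedge a (\sum_(t <- s) c t *: f t) = \sum_(t <- s) c t *: wedge a (f t).
Proof.
apply/ffunP => K; rewrite ffunE sum_ffunE.
under eq_bigr do rewrite sum_ffunE mulr_sumr.
rewrite exchange_big /=; apply: eq_bigr => t _.
rewrite !ffunE scale_regularE mulr_sumr; apply: eq_bigr => I _.
by rewrite ffunE scale_regularE mulrCA.
Qed.

Lemma hodge_sum (T : Type) (s : seq T) (c : T -> R) (f : T -> extalg R n) :
  hodge (\sum_(t <- s) c t *: f t) = \sum_(t <- s) c t *: hodge (f t).
Proof.
apply/ffunP => K; rewrite ffunE !sum_ffunE mulr_sumr; apply: eq_bigr => t _.
by rewrite !ffunE scale_regularE mulrCA.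
Qed.

Lemma wedgeDr a b w : wedge a (b + w) = wedge a b + wedge a w.
Proof.
have := @wedge_sumr bool [:: true; false] (fun=> 1) (fun t => if t then b else w) a.
by rewrite !big_cons !big_nil !addr0 !scale1r.
Qed.

Lemma wedgeZr (c : R) a b : wedge a (c *: b) = c *: wedge a b.
Proof.
have := @wedge_sumr unit [:: tt] (fun=> c) (fun=> b) a.
by rewrite !big_cons !big_nil !addr0.
Qed.

Lemma dot_sumr (T : Type) (s : seq T) (c : T -> R) (f : T -> extalg R n) a :
  dot a (\sum_(t <- s) c t *: f t) = \sum_(t <- s) c t * dot a (f t).
Proof.
rewrite /dot; under eq_bigr do rewrite sum_ffunE mulr_sumr.
rewrite exchange_big; apply: eq_bigr => t _; rewrite mulr_sumr; apply: eq_bigr => I _.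
by rewrite ffunE scale_regularE mulrCA.
Qed.

Lemma dotZr (c : R) a b : dot a (c *: b) = c * dot a b.
Proof. by have := dot_sumr [:: tt] (fun=> c) (fun=> b) a; rewrite !big_seq1. Qed.

Lemma dotNr a b : dot a (- b) = - dot a b.
Proof. by rewrite -scaleN1r dotZr mulN1r. Qed.

Lemma dotC a b : dot a b = dot b a.
Proof. by apply: eq_bigr => I _; rewrite mulrC. Qed.

Lemma dot_dxr a i : dot a (dx i) = a [set i].
Proof.
rewrite /dot (bigD1 [set i]) //= big1 ?addr0 ?ffunE ?eqxx ?mulr1 // => I Ii.
by rewrite ffunE (negPf Ii) mulr0.
Qed.

Lemma homogeneous_dx i : homogeneous 1 (dx i : extalg R n).
Proof.
by move=> I I1; rewrite ffunE; case: eqP => // Ii; rewrite Ii cards1 in I1.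
Qed.

Lemma volume_formE K : hodge (form0 1 : extalg R n) K = (K == setT)%:R.
Proof.
rewrite ffunE ffunE cards_eq0; have -> : (~: K == set0) = (K == setT).
  by rewrite -(inj_eq (@setC_inj _)) setCK setC0.
case: eqP => [->|_]; last by rewrite mulr0.
by rewrite mulr1 shuffle_sign_prod setCT big_set0.
Qed.

Lemma dot_volume_form a : dot (hodge (form0 1)) a = a setT.
Proof.
rewrite dotC /dot (bigD1 setT) //= big1 ?addr0 ?volume_formE ?eqxx ?mulr1 // => I Ii.
by rewrite volume_formE (negPf Ii) mulr0.
Qed.

Lemma wedge_dx_form0 i (c : R) : wedge (dx i) (form0 c) = c *: dx i.
Proof.
apply/ffunP => K; rewrite wedge_dxl [in RHS]ffunE scale_regularE !ffunE cards_eq0.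
case: ifPn => iK; last first.
  by case: eqP => [Ki|_]; [rewrite Ki inE eqxx in iK|rewrite mulr0].
rewrite setD_eq0 subset1; have [->|Ki] /= := eqVneq K [set i].
  rewrite setDv (_ : shuffle_sign _ _ = 1) ?mul1r ?mulr1 //.
  by have := shuffle_sign_prod [set i] set0; rewrite big_set1 big_set0.
by case: eqP => [K0|_]; [rewrite K0 inE in iK|rewrite !mulr0].
Qed.

Lemma wedge_dxC i l : wedge (dx i) (dx l) = - wedge (dx l) (dx i) :> extalg R n.
Proof.
apply/ffunP => K; rewrite [RHS]ffunE !wedge_dxl.
have [il|il] := eqVneq i l.
  rewrite -il ffunE; case: ifP => _; last by rewrite oppr0.
  by case: eqP => [/setP/(_ i)|_]; rewrite ?mulr0 ?oppr0 // !inE eqxx.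
have E p q : K :\ p = [set q] -> p \in K -> K = [set p; q].
  by move=> <- pK; rewrite setD1K.
rewrite !ffunE.
have [K1|K1] := eqVneq K [set i; l].
  have Di : [set i; l] :\ i = [set l] by rewrite setU1K ?inE.
  have Dl : [set i; l] :\ l = [set i] by rewrite setUC setU1K // inE eq_sym.
  rewrite K1 Di Dl !eqxx set21 set22 !mulr1.
  by rewrite !shuffle_sign1; exact: transpose_signC.
case: ifP => [iK|_]; case: ifP => [lK|_]; rewrite ?oppr0 //.
all: repeat (case: eqP => [/E/(_ _) H|_]; rewrite ?mulr0 ?oppr0 //).
all: by case/eqP: K1; rewrite H // setUC.
Qed.

Lemma wedge_dx_hodge_dx i l :
  wedge (dx i) (hodge (dx l)) = (i == l)%:R *: hodge (form0 1) :> extalg R n.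
Proof.
rewrite (wedge_hodge (k := 1)) ?dot_dxr ?ffunE; [|exact: homogeneous_dx..].
by rewrite (inj_eq (@set1_inj _)) eq_sym.
Qed.

(* The sign comes from moving [dx l] past the (n - 2)-form [hodge B]. *)
Lemma wedge_dx_wedge_hodge i l (B : extalg R n) : homogeneous 2 B ->
  wedge (dx i) (wedge (hodge B) (dx l)) =
  ((-1) ^+ n * dot B (wedge (dx i) (dx l))) *: hodge (form0 1).
Proof.
move=> hB; apply/ffunP => K; rewrite wedge_dxl wedge_dxr [RHS]ffunE volume_formE.
rewrite scale_regularE ffunE.
(* Below top degree both sides vanish: [hodge B] is nonzero only on sets whose complement has two
   elements, and adding i and l to such a set gives n elements. *)
have [->|KT] := eqVneq K setT; last first.
  rewrite mulr0; case: ifP => // iK; case: ifP => lK; last by rewrite mulr0.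
  rewrite hB ?mulr0 //; apply: contraNneq KT => M2.
  rewrite eqEcard subsetT cardsT card_ord.
  have : (#|K :\ i :\ l| + 2)%N = n by rewrite -M2 cardsC card_ord.
  rewrite (cardsD1 i K) iK (cardsD1 l (K :\ i)) lK => E; rewrite -[X in (X <= _)%N]E addnC. exact: leqnn.
rewrite mulr1 inE /=.
have dotE : dot B (wedge (dx i) (dx l)) =
    if i == l then 0 else transpose_sign i l * B [set i; l].
  rewrite /dot; have [il|il] := eqVneq i l.
    apply: big1 => I _; rewrite wedge_dxl -il !ffunE.
    case: ifP => _; last by rewrite mulr0.
    by case: eqP => [/setP/(_ i)|_]; rewrite ?mulr0 // !inE eqxx.
  have Di : [set i; l] :\ i = [set l] by rewrite setU1K ?inE.
  rewrite (bigD1 [set i; l]) //= big1 ?addr0 => [|I Iil].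
    by rewrite wedge_dxl set21 Di ffunE eqxx mulr1 shuffle_sign1 mulrC.
  rewrite wedge_dxl ffunE; case: ifP => iI; last by rewrite mulr0.
  case: eqP => [Il|_]; last by rewrite !mulr0.
  by case/eqP: Iil; rewrite -Il setD1K.
rewrite dotE !inE andbT; have [il|il] := eqVneq i l.
  by rewrite /= ?mulr0 ?mul0r.
rewrite /= setDDl.
set M := setT :\: (_ :|: _).
have CM : ~: M = [set i; l] by rewrite /M setTD setCK.
have MC : M = ~: [set i; l] by rewrite -CM setCK.
have cM : (#|M| + 2)%N = n.
  have := cardsC M; rewrite CM card_ord => E; rewrite -[RHS]E.
  by rewrite cards2 il.
have iM : i \notin M by rewrite MC !inE eqxx.
have lM : l \notin M by rewrite MC !inE eqxx orbT.
have -> : setT :\ i = l |: M.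
  by apply/setP => p; rewrite MC !inE; case: (p =P l) => [->|]; rewrite ?andbT ?orbF // eq_sym il.
rewrite CM; have -> : B [set i; l] = B [set i; l] :> R by [].
rewrite !shuffle_sign_prod big_set1 big_setU1 //= big_setU1 ?inE //= !big_set1.
under [X in _ * (X * _)]eq_bigr do rewrite big_set1.
have sq : (\prod_(p in M) transpose_sign i p) * (\prod_(p in M) transpose_sign i p) = 1.
  by rewrite -big_split /= big1 // => p _; exact: transpose_sign_sqr.
(* Each of the n - 2 indices in M contributes one -1 when dx_l passes it, and n - 2 has the parity
   of n. *)
have sl : (\prod_(p in M) transpose_sign l p) * (\prod_(p in M) transpose_sign p l) = (-1) ^+ n.
  have -> : (-1) ^+ n = (-1) ^+ #|M| :> R.
    have -> : (-1) ^+ n = (-1) ^+ (#|M| + 2) :> R by rewrite cM.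
    by rewrite exprD sqrrN expr1n mulr1.
  rewrite -big_split /= -prodr_const.
  apply: eq_bigr => p pM; rewrite (transpose_signC (i := l)).
    by rewrite mulNr transpose_sign_sqr.
  by apply: contraNneq lM => ->.
rewrite -sl.
set x := \prod_(p in M) transpose_sign i p in sq *.
transitivity (x * x * ((\prod_(p in M) transpose_sign l p) * (\prod_(p in M) transpose_sign p l) *
 (transpose_sign i l * B [set i; l]))); last by rewrite sq mul1r.
ring.
Qed.

End exterior_algebra_lemmas.

From mathcomp Require Import all_classical all_reals all_analysis.
From mathcomp Require Import measurable_realfun ess_sup_inf.

Import Order.TTheory GRing.Theory Num.Theory.
Import numFieldNormedType.Exports.

Local Open Scope classical_set_scope.
Local Open Scope ring_scope.

(** * Lebesgue measure on R^n *)

Section lebesgue_rV_shift.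
Context {R : realType}.

Lemma lebesgue_measure_shift (c : R) (A : set (measurableTypeR R)) :
  measurable A ->
  lebesgue_measure ((fun x : measurableTypeR R => x + c) @^-1` A)
    = lebesgue_measure A.
Proof.
move=> mA.
have mc : measurable_fun [set: measurableTypeR R]
    ((fun x => x + c) : measurableTypeR R -> measurableTypeR R).
  by apply: (@measurable_funD _ (measurableTypeR R) R setT id (cst c)).
apply/esym; apply: (@lebesgue_measure_unique R
  (pushforward lebesgue_measure (fun x : measurableTypeR R => x + c : measurableTypeR R))) => //= _ [[a b]] _ <-.
rewrite /pushforward /=.
rewrite (_ : _ @^-1` _ = `]a - c, b - c]%classic); last first.
  by apply/seteqP; split=> x /=; rewrite !in_itv/= ltrBlDr lerBrDr.
by rewrite !lebesgue_measure_itv/= !lte_fin ltrD2r -!EFinD opprB addrA addrNK.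
Qed.

Lemma measurable_rV_shift n (z : 'rV[R]_n) :
  measurable_fun [set: 'rV[R]_n] (fun x : 'rV[R]_n => x + z).
Proof.
apply: measurable_fun_rV => i.
rewrite (_ : (fun _ => _) = (fun x : 'rV[R]_n => x ord0 i + z ord0 i)).
  by apply: measurable_funD => //; exact: measurable_coord.
by apply/funext => x; rewrite mxE.
Qed.

(** Induction on the dimension: the shifted product measure agrees with the product measure on
    rectangles, which determine it. In dimension 0 every shift is the identity. *)
Lemma lebesgue_rV_shift n (z : 'rV[R]_n) (A : set 'rV[R]_n) : measurable A ->
  lebesgue_rV n ((fun x => x + z) @^-1` A) = lebesgue_rV n A.
Proof.
elim: n z A => [|n IH] z A mA.
  rewrite (_ : (fun x => x + z) = id) //; apply/funext => x.
  by rewrite [LHS]thinmx0 [RHS]thinmx0.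
pose s (p : measurableTypeR R * 'rV[R]_n) : measurableTypeR R * 'rV[R]_n :=
  (p.1 + z ord0 ord0, p.2 + (rVuncons z).2).
have ms : measurable_fun setT s.
  apply/measurable_fun_pairP; split.
    apply: (@measurable_funD _ _ R setT fst (cst (z ord0 ord0))) => //.
  exact: (measurableT_comp (measurable_rV_shift _) measurable_snd).
rewrite /= /lebesgue_step /pushforward.
transitivity (pushforward (lebesgue_measure \x lebesgue_rV n)%E s (@rVcons R n @^-1` A)).
  rewrite /pushforward.
  have cs p : rVcons p + z = rVcons (s p).
    apply/rowP => i; rewrite !mxE.
    by case: unliftP => [j ->|->] //=; rewrite !mxE.
  have E : rVcons (n:=n) @^-1` ((fun x : 'rV[R]_n.+1 => x + z) @^-1` A) =
      s @^-1` (rVcons (n:=n) @^-1` A).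
    by apply/funext => p /=; rewrite cs.
  exact: (congr1 (lebesgue_measure \x lebesgue_rV n)%E E).
apply/esym; apply: product_measure_unique; last first.
  by rewrite -[X in measurable X]setTI; exact: measurable_rVcons.
move=> B C mB mC; rewrite /pushforward.
have mB' : measurable ((fun x : measurableTypeR R => x + z ord0 ord0) @^-1` B).
  by rewrite -[X in measurable X]setTI; apply: (@measurable_funD _ _ R setT id (cst (z ord0 ord0))).
have mC' : measurable ((fun x => x + (rVuncons z).2) @^-1` C).
  by rewrite -[X in measurable X]setTI; apply: measurable_rV_shift.
transitivity ((lebesgue_measure \x lebesgue_rV n)%E
  (((fun x : measurableTypeR R => x + z ord0 ord0) @^-1` B) `*`
   ((fun x => x + (rVuncons z).2) @^-1` C))) => //.
rewrite product_measure1E//.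
by congr (_ * _)%E; [exact: lebesgue_measure_shift | exact: IH].
Qed.

Lemma ge0_integral_rV_shift n (z : 'rV[R]_n) (f : 'rV[R]_n -> \bar R) :
  measurable_fun setT f -> (forall x, 0 <= f x)%E ->
  (\int[lebesgue_rV n]_x f (x + z)%R = \int[lebesgue_rV n]_x f x)%E.
Proof.
move=> mf f0.
have mz := measurable_rV_shift z.
transitivity (\int[pushforward (lebesgue_rV n) (fun x : 'rV[R]_n => x + z)%R]_x f x)%E.
  by rewrite (ge0_integral_pushforward mz).
by apply: eq_measure_integral => A mA _; exact: lebesgue_rV_shift.
Qed.

Lemma integrable_rV_shift n (z : 'rV[R]_n) (f : 'rV[R]_n -> R) :
  (lebesgue_rV n).-integrable setT (EFin \o f) ->
  (lebesgue_rV n).-integrable setT (EFin \o (fun x => f (x + z))).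
Proof.
move=> /integrableP[mf foo]; apply/integrableP; split.
  exact: (measurableT_comp mf (measurable_rV_shift z)).
have := @ge0_integral_rV_shift n z (fun x => `|(f x)%:E|)%E.
by move=> -> //; exact: measurableT_comp.
Qed.

Lemma integral_rV_shift n (z : 'rV[R]_n) (f : 'rV[R]_n -> R) :
  (lebesgue_rV n).-integrable setT (EFin \o f) ->
  \int[lebesgue_rV n]_x f (x + z) = \int[lebesgue_rV n]_x f x.
Proof.
move=> fi; rewrite /Rintegral; congr fine.
have mz := measurable_rV_shift z.
transitivity (\int[pushforward (lebesgue_rV n) (fun x : 'rV[R]_n => x + z)%R]_x (f x)%:E)%E.
  rewrite (integral_pushforward mz) => //; first exact: measurable_int fi.
  exact: integrable_rV_shift.
by apply: eq_measure_integral => A mA _; exact: lebesgue_rV_shift.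
Qed.

Lemma measurable_rV_box n (J : 'I_n -> interval R) :
  measurable [set x : 'rV[R]_n | forall i, x ord0 i \in J i].
Proof.
rewrite (_ : mkset _ = \bigcap_(i in [set: 'I_n])
    (fun x : 'rV[R]_n => x ord0 i) @^-1` [set` J i]).
  apply: fin_bigcap_measurable => // i _.
  by rewrite -[X in measurable X]setTI; exact: measurable_coord.
by apply/seteqP; split => [x bx i _|x bx i]; exact: bx.
Qed.

(** The sigma-algebra is generated by the coordinates, so this needs countability: U is the union of
    the boxes inside it with rational centre and half-side 1/(k+1). *)
Lemma open_measurable_rV n (U : set 'rV[R]_n) : open U -> measurable U.
Proof.
move=> oU.
pose box (p : 'rV[rat]_n * nat) : set 'rV[R]_n :=
  [set x | forall i, x ord0 i \in
     `](ratr (p.1 ord0 i) - p.2.+1%:R^-1), (ratr (p.1 ord0 i) + p.2.+1%:R^-1)[].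
have mbox p : measurable (box p) by exact: measurable_rV_box.
rewrite (_ : U = \bigcup_p (if `[< box p `<=` U >] then box p else set0)).
  apply: countable_bigcupT_measurable => [|p]; first exact: countableP.
  by case: ifP.
apply/seteqP; split => [x Ux|x [p _]]; last by case: ifPn => // /asboolP h /h.
have /nbhs_ballP[e /= e0 eU] : nbhs x U by exact: open_nbhs_nbhs.
have [k ke] : exists k : nat, k.+1%:R^-1 < e / 2 :> R.
  have e2 : 0 < e / 2 by rewrite divr_gt0.
  have [N _ HN] := near_infty_natSinv_lt (PosNum e2).
  by exists N; exact: HN (leqnn N).
have ex i : exists q : rat, `|x ord0 i - ratr q| < k.+1%:R^-1.
  have : x ord0 i - k.+1%:R^-1 < x ord0 i + k.+1%:R^-1.
    by rewrite ltrBlDr -addrA ltrDl addr_gt0 // invr_gt0.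
  move=> /rat_in_itvoo[q]; rewrite in_itv/= => /andP[q1 q2]; exists q.
  by rewrite distrC ltr_distl q1 q2.
have [q Hq] := choice ex.
have xb : box (\row_i q i, k) x.
  by move=> i /=; rewrite mxE in_itv/= -ltr_distl; exact: Hq.
exists (\row_i q i, k) => //; case: ifPn => // /asboolPn; case => y yb.
apply: eU; split => // a j; rewrite ord1 [e]splitr.
have := yb j; rewrite /= mxE in_itv/= -ltr_distl => yq.
rewrite /ball/= -(subrKA (ratr (q j))) (le_lt_trans (ler_normD _ _))//.
rewrite ltrD//; first exact: lt_trans (Hq j) ke.
by rewrite distrC; exact: lt_trans yq ke.
Qed.

Lemma continuous_measurable_rV n (f : 'rV[R]_n -> R) :
  continuous f -> measurable_fun setT f.
Proof.
move=> /continuousP cf; apply: (measurability _ (RGenOpens.measurableE R)).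
move=> _ [_ [a [b ->] <-]]; rewrite setTI.
by apply: open_measurable_rV; apply: cf; exact: interval_open.
Qed.

(** Lets a monotone class argument about measurable sets start from the open ones, in
    [L1_translation_continuous_indic]. *)
Lemma measurable_rV_openE n : @measurable _ 'rV[R]_n = <<s @open 'rV[R]_n >>.
Proof.
rewrite eqEsubset; split; last first.
  apply: smallest_sub; last by move=> U; exact: open_measurable_rV.
  by split => *; [exact: measurable0|rewrite setTD; exact: measurableC|exact: bigcupT_measurable].
apply: smallest_sub; first exact: smallest_sigma_algebra.
move=> A; rewrite -bigcup_seq => -[i _ [Y + <-]]; rewrite setTI.
suff : @measurable _ (measurableTypeR R) `<=`
    [set Y | <<s @open 'rV[R]_n >> ((fun x : 'rV[R]_n => x ord0 i) @^-1` Y)].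
  by move=> /(_ Y).
rewrite [X in X `<=` _]RGenOpens.measurableE; apply: smallest_sub; first split.
- by rewrite /= preimage_set0; exact: sigma_algebra0.
- by move=> B sB /=; rewrite setTD preimage_setC -setTD; exact: sigma_algebraCD.
- by move=> F sF /=; rewrite preimage_bigcup; exact: sigma_algebra_bigcup.
- move=> _ [a [b ->]] /=; apply: sub_sigma_algebra.
  apply: open_comp; last exact: interval_open.
  by move=> x _; exact: coord_continuous.
Qed.

End lebesgue_rV_shift.

(** * Continuity of translations and of correlations *)

Lemma cvge0_near_le {R : realType} (u : nat -> \bar R) : u @ \oo --> 0%E ->
  forall e : R, 0 < e -> \forall k \near \oo, (u k <= e%:E)%E.
Proof.
move=> u0 e e0; have : \forall k \near \oo, (u k < e%:E)%E.
  by apply: (u0 [set y | y < e%:E]%E); apply: open_ereal_lt'; rewrite lte_fin.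
by apply: filterS => k /ltW.
Qed.

Section translation_continuity.
Context {R : realType} (n : nat).
Local Notation V := 'rV[R]_n.
Local Notation mu := (lebesgue_rV n : {sigma_finite_measure set V -> \bar R}).
Implicit Types (f g : V -> R) (K : set V) (z : V).

Definition translation_dist f (z : V) : \bar R :=
  (\int[mu]_x `|f (x + z)%R - f x|%:E)%E.

(** Continuity is asked along one sequence of translations, the setting of dominated convergence. *)
Definition L1_translation_continuous (z_ : nat -> V) f : Prop :=
  mu.-integrable setT (EFin \o f) /\
  forall e : R, 0 < e -> \forall k \near \oo, (translation_dist f (z_ k) <= e%:E)%E.

Lemma measurable_shiftB f (z : V) : measurable_fun setT f ->
  measurable_fun setT (fun x : V => f (x + z) - f x).
Proof.
move=> mf; apply: measurable_funB => //.
exact: (measurableT_comp mf (measurable_rV_shift z)).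
Qed.

Lemma measurable_norm_shiftB f (z : V) : measurable_fun setT f ->
  measurable_fun setT (fun x : V => (`|f (x + z) - f x|%:E)).
Proof.
move=> mf; apply/measurable_EFinP; apply: measurableT_comp => //.
exact: measurable_shiftB.
Qed.

Lemma translation_distB_le f g z : measurable_fun setT f -> measurable_fun setT g ->
  (translation_dist (fun x => f x - g x)%R z <=
   translation_dist f z + translation_dist g z)%E.
Proof.
move=> mf mg; rewrite /translation_dist -ge0_integralD//=; last 2 first.
- exact: measurable_norm_shiftB.
- exact: measurable_norm_shiftB.
apply: ge0_le_integral => //.
- by apply: (@measurable_norm_shiftB (fun x => f x - g x)); exact: measurable_funB.
- exact: (emeasurable_funD (measurable_norm_shiftB z mf) (measurable_norm_shiftB z mg)).
move=> x _; rewrite -EFinD lee_fin.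
by rewrite opprD opprK addrACA (addrC (- g _)) -(opprB (g _)); exact: ler_normB.
Qed.

Lemma translation_distZ f (c : R) z : measurable_fun setT f ->
  (translation_dist (fun x => c * f x)%R z = `|c|%:E * translation_dist f z)%E.
Proof.
move=> mf; rewrite /translation_dist -ge0_integralZl//=.
- by apply: eq_integral => x _; rewrite -EFinM -normrM mulrBr.
- exact: measurable_norm_shiftB.
Qed.

Lemma translation_dist_le_norm f z : measurable_fun setT f ->
  (translation_dist f z <= 2%:E * \int[mu]_x `|f x|%:E)%E.
Proof.
move=> mf.
have mnf : measurable_fun setT (fun x => `|f x|%:E).
  by apply/measurable_EFinP; exact: measurableT_comp.
have E := ge0_integral_rV_shift z mnf (fun x => normr_ge0 (f x)).
rewrite (_ : 2%:E = 1 + 1)%E // ge0_muleDl// !mul1e -{1}E -ge0_integralD//=.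
  apply: ge0_le_integral => //.
  - exact: measurable_norm_shiftB.
  - apply: (emeasurable_funD _ mnf).
    exact: (measurableT_comp mnf (measurable_rV_shift z)).
  - by move=> x _; rewrite -EFinD lee_fin; exact: ler_normB.
exact: (measurableT_comp mnf (measurable_rV_shift z)).
Qed.

Let integrable_measurable f : mu.-integrable setT (EFin \o f) -> measurable_fun setT f.
Proof. by move/measurable_int/measurable_EFinP. Qed.

Section sequence.
Variable z_ : nat -> V.
Local Notation tcont := (L1_translation_continuous z_).

Lemma L1_translation_continuousB f g : tcont f -> tcont g -> tcont (fun x => f x - g x).
Proof.
move=> [fi fc] [gi gc]; split.
  rewrite (_ : _ \o _ = (fun x => (f x)%:E - (g x)%:E)%E) //.
  exact: integrableB.
move=> e e0; have e2 : 0 < e / 2 by rewrite divr_gt0.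
near=> k; apply: (le_trans (translation_distB_le _ _ _)).
- exact: integrable_measurable.
- exact: integrable_measurable.
rewrite [e]splitr EFinD; apply: leeD; near: k; [exact: fc|exact: gc].
Unshelve. all: by end_near. Qed.

Lemma L1_translation_continuousZ f (c : R) : tcont f -> tcont (fun x => c * f x).
Proof.
move=> [fi fc]; split.
  by apply: (eq_integrable _ (fun x => c%:E * (f x)%:E)%E) => //; exact: integrableZl.
move=> e e0.
have e2 : 0 < e / (`|c| + 1) by rewrite divr_gt0 // ltr_wpDl.
near=> k; rewrite translation_distZ; last exact: integrable_measurable.
apply: (@le_trans _ _ (`|c|%:E * (e / (`|c| + 1))%:E)%E).
  by apply: lee_wpmul2l => //; near: k; exact: fc.
by rewrite -EFinM lee_fin mulrCA ler_piMr ?(ltW e0)// ler_pdivrMr ?mul1r ?lerDl// ltr_wpDl.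
Unshelve. all: by end_near. Qed.

Lemma L1_translation_continuous_approx f : mu.-integrable setT (EFin \o f) ->
  (forall e : R, 0 < e -> exists2 g, tcont g &
     (\int[mu]_x `|(f x - g x)%R|%:E <= e%:E)%E) -> tcont f.
Proof.
move=> fi H; split => // e e0.
(* By [translation_dist_le_norm] the error f - g is moved by at most twice its L1 norm, hence by e /
   2. *)
have e4 : 0 < e / 4 by rewrite divr_gt0.
have [g [gi gc] fg] := H _ e4.
have mf := integrable_measurable fi; have mg := integrable_measurable gi.
have e2 : 0 < e / 2 by rewrite divr_gt0.
have mfg : measurable_fun setT (fun x => f x - g x) by exact: measurable_funB.
near=> k.
(* A sum written as a difference, the shape that [translation_distB_le] takes. *)
have -> : f = (fun x => (f x - g x) - (- 1 * g x)).
  by apply/funext => x; rewrite mulN1r opprK subrK.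
apply: (le_trans (translation_distB_le _ _ _)) => //.
  by apply: measurable_funM.
rewrite [e]splitr EFinD; apply: leeD.
  apply: (le_trans (translation_dist_le_norm _ _)) => //.
  apply: (@le_trans _ _ (2%:E * (e / 4)%:E)%E); first exact: lee_wpmul2l.
  rewrite -EFinM lee_fin mulrCA ler_wpM2l// ?(ltW e0)//.
  by rewrite -[4]/(2 * 2)%:R natrM invfM mulVKf.
rewrite translation_distZ// normrN1 mul1e; near: k; exact: gc.
Unshelve. all: by end_near. Qed.

Hypothesis z0 : z_ @ \oo --> (0 : V).

(** A point of F stays in F under small translations, so the part of F that leaves F tends to
    measure 0 by dominated convergence. Points that enter F need not behave well one by one, at the
    boundary for instance, but translation invariance gives them the same total measure as those
    that leave. *)
Lemma L1_translation_continuous_open (F : set V) : open F -> (mu F < +oo)%E ->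
  tcont (\1_F : V -> R).
Proof.
move=> oF Foo; have mF : measurable F by exact: open_measurable_rV.
have mI : measurable_fun setT (\1_F : V -> R) by exact: measurable_indic.
have Fi : mu.-integrable setT (EFin \o (\1_F : V -> R)).
  apply/integrableP; split; first exact/measurable_EFinP.
  rewrite (_ : (fun x => `|_|)%E = (fun x => (\1_F x)%:E)).
    by rewrite integral_indic // setIT.
  by apply/funext => x; rewrite /= ger0_norm.
have mIz k : measurable_fun setT (fun x : V => \1_F (x + z_ k) : R).
  exact: (measurableT_comp mI (measurable_rV_shift _)).
split => //.
pose h k (x : V) : \bar R := (\1_F x * (1 - \1_F (x + z_ k)))%:E.
have mh k : measurable_fun setT (h k).
  apply/measurable_EFinP; apply: measurable_funM => //.
  exact: measurable_funB.
have h01 k x : (0 : R) <= (\1_F x : R) * (1 - \1_F (x + z_ k)) <= \1_F x.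
  by rewrite !indicE; do 2 case: (_ \in _); rewrite /= ?(subrr, subr0, mul0r, mulr0, mulr1, lexx, ler01).
(* |1_F(x+z) - 1_F(x)| + 1_F(x) = 2 1_F(x)(1 - 1_F(x+z)) + 1_F(x+z), and 1_F has the
   same integral as its translates. *)
have E k : (translation_dist (\1_F) (z_ k) <= 2%:E * \int[mu]_x h k x)%E.
  have fin : (\int[mu]_x (\1_F x)%:E)%E \is a fin_num.
    by rewrite integral_indic // setIT ge0_fin_numE.
  rewrite -(leeD2rE _ _ fin).
  have mFE : measurable_fun setT (fun x : V => (\1_F x)%:E : \bar R) by exact/measurable_EFinP.
  have Ez := ge0_integral_rV_shift (z_ k) mFE (fun x => ltac:(by rewrite lee_fin)).
  rewrite /= -{2}Ez.
  have h0 x : (0 <= h k x)%E by rewrite lee_fin; case/andP: (h01 k x).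
  rewrite (_ : 2%:E = 1 + 1)%E // ge0_muleDl// !mul1e.
  have mFz : measurable_fun setT (fun x : V => (\1_F (x + z_ k))%:E : \bar R).
    exact/measurable_EFinP.
  rewrite /translation_dist.
  have mhh : measurable_fun setT (h k \+ h k)%E by exact: emeasurable_funD.
  have m1 := measurable_norm_shiftB (z_ k) mI.
  rewrite -!ge0_integralD//=; last by move=> x _; rewrite adde_ge0.
  apply: ge0_le_integral => //.
  - by move=> x _; rewrite -EFinD lee_fin addr_ge0.
  - exact: (emeasurable_funD m1 mFE).
  - exact: (emeasurable_funD mhh mFz).
  move=> x _; rewrite -!EFinD lee_fin !indicE.
  do 2 case: (_ \in _); rewrite /= ?(subrr, subr0, sub0r, mul0r, mulr0, mulr1, normrN1, normr1, normr0, addr0, add0r) //.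
have h_cvg x : h ^~ x @ \oo --> 0%E.
  have [xF|xF] := pselect (F x); last first.
    rewrite (_ : h ^~ x = cst 0%E); first exact: cvg_cst.
    by apply/funext => k; rewrite /h indicE memNset // mul0r.
  have xz : (fun k => x + z_ k) @ \oo --> x.
    by rewrite -[X in _ --> X]addr0; apply: cvgD => //; exact: cvg_cst.
  have Fx : \forall k \near \oo, F (x + z_ k).
    by apply: (xz F); exact: open_nbhs_nbhs.
  apply: (@cvg_near_cst _ _ 0%E).
  apply: filterS Fx => k Fk.
  by rewrite /h !indicE (mem_set Fk) (mem_set xF) subrr mulr0.
have [||_ _ hc] := @dominated_convergence _ _ _ mu setT measurableT h (cst 0%E)
  (EFin \o \1_F) mh (measurable_cst _) _ Fi _.
- by apply: aeW => x _; exact: h_cvg.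
- apply: aeW => x k _; have /andP[h0 h1] := h01 k x.
  by rewrite /h gee0_abs lee_fin.
rewrite integral_cst0 // in hc || rewrite integral0 in hc.
move=> e e0; have e2 : 0 < e / 2 by rewrite divr_gt0.
have := cvge0_near_le hc e2; apply: filterS => k hk.
apply: (le_trans (E k)); apply: (@le_trans _ _ (2%:E * (e / 2)%:E)%E).
  exact: lee_wpmul2l.
by rewrite -EFinM lee_fin mulrC divfK.
Qed.

(** The sets F with this property form a lambda-system containing the open sets, which are stable
    under intersection. Cutting by K keeps every indicator in L1, and [\1_K] is the dominating
    function for increasing unions. *)
Lemma L1_translation_continuous_indic (K F : set V) :
  open K -> (mu K < +oo)%E -> measurable F -> tcont (\1_(F `&` K) : V -> R).
Proof.
move=> oK Koo mF; have mK : measurable K by exact: open_measurable_rV.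
pose H := [set F | measurable F /\ tcont (\1_(F `&` K) : V -> R)].
suff : <<s @open V >> `<=` H by rewrite -measurable_rV_openE => /(_ F mF)[].
apply: lambda_system_subset => //.
- by move=> A B; exact: openI.
- split => //.
  + split; first exact: measurableT.
    by rewrite setTI; exact: L1_translation_continuous_open.
  + move=> A B BA [mA HA] [mB HB]; split; first exact: measurableD.
    rewrite (_ : \1_((A `\` B) `&` K) = (fun x => \1_(A `&` K) x - \1_(B `&` K) x)).
      exact: L1_translation_continuousB.
    apply/funext => x; rewrite !indicE setDE !classical_sets.in_setI classical_sets.in_setC.
    have [/set_mem/BA/mem_set ->|] := boolP (x \in B); last by rewrite andbT subr0.
    by rewrite andbF subrr.
  + move=> G ndG HG; have mG : measurable (\bigcup_i G i).
      by apply: bigcupT_measurable => k; have [] := HG k.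
    split => //.
    have KI : mu.-integrable setT (EFin \o (\1_K : V -> R)).
      by have [] := L1_translation_continuous_open oK Koo.
    have mI A : measurable A -> measurable_fun setT (fun x : V => (\1_(A `&` K) x)%:E : \bar R).
      by move=> mA; apply/measurable_EFinP; apply: measurable_indic; exact: measurableI.
    have [||GI Gc _] := @dominated_convergence _ _ _ mu setT measurableT
      (fun k x => (\1_(G k `&` K) x)%:E) (fun x => (\1_(\bigcup_i G i `&` K) x)%:E)
      (EFin \o \1_K) (fun k => mI _ (HG k).1) (mI _ mG) _ KI _.
    * apply: aeW => x _.
      have [[k _ Gkx]|nG] := pselect ((\bigcup_i G i) x); last first.
        rewrite (_ : (fun _ => _) = cst (\1_(\bigcup_i G i `&` K) x)%:E); first exact: cvg_cst.
        apply/funext => k; rewrite !indicE !classical_sets.in_setI (memNset nG) memNset// => Gkx.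
        by apply: nG; exists k.
      apply: cvg_near_cst; exists k => // l /= kl.
      have Glx : G l x by have /subsetPset h := ndG _ _ kl; exact: h.
      have Gx : (\bigcup_i G i) x by exists k.
      by rewrite !indicE !classical_sets.in_setI (mem_set Glx) (mem_set Gx).
    * apply: aeW => x k _; rewrite gee0_abs lee_fin // !indicE classical_sets.in_setI.
      by case: (_ \in K); rewrite ?andbF // andbT; case: (_ \in _).
    apply: L1_translation_continuous_approx => // e e0.
    have [N _ /(_ N (leqnn N)) HN] := cvge0_near_le Gc e0.
    exists (\1_(G N `&` K)); first by have [] := HG N.
    apply: le_trans HN; rewrite le_eqVlt; apply/orP; left; apply/eqP.
    by apply: eq_integral => x _; rewrite distrC.
- by move=> U oU; split; [exact: open_measurable_rV|];
    apply: L1_translation_continuous_open; [exact: openI|];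
    apply: le_lt_trans Koo; apply: le_measure; rewrite ?inE//;
    apply: open_measurable_rV => //; exact: openI.
Qed.

Lemma L1_translation_continuousD f g : tcont f -> tcont g -> tcont (fun x => f x + g x).
Proof.
move=> tf tg; rewrite (_ : (fun _ => _) = (fun x => f x - (- 1) * g x)).
  by apply: L1_translation_continuousB => //; exact: L1_translation_continuousZ.
by apply/funext => x; rewrite mulN1r opprK.
Qed.

Lemma L1_translation_continuous0 : tcont (fun=> 0).
Proof.
split; first exact: integrable0.
move=> e e0; apply: nearW => k; rewrite /translation_dist.
under eq_integral do rewrite subrr normr0.
by rewrite integral0 lee_fin ltW.
Qed.

Import HBSimple.

Lemma L1_translation_continuous_sum (I : Type) (s : seq I) (f : I -> V -> R) :
  (forall i, tcont (f i)) -> tcont (fun x => \sum_(i <- s) f i x).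
Proof.
move=> tf; elim: s => [|i s IH].
  by under eq_fun do rewrite big_nil; exact: L1_translation_continuous0.
by under eq_fun do rewrite big_cons; exact: L1_translation_continuousD.
Qed.

Lemma L1_translation_continuous_sfun (K : set V) (g : {sfun V >-> R}) :
  open K -> (mu K < +oo)%E -> tcont (fun x => g x * \1_K x).
Proof.
move=> oK Koo.
under eq_fun => x do rewrite fimfunEord mulr_suml.
apply: L1_translation_continuous_sum => i.
under eq_fun => x do rewrite -mulrA -[\1__ x * _]/((_ \* _) x) -indicI.
apply: L1_translation_continuousZ; apply: L1_translation_continuous_indic => //.
Qed.

(** Multiplying an approximating simple function by [\1_K] does not increase its distance to f,
    which vanishes off K, and makes it a combination of indicators of sets [F :&: K]. *)
Lemma L1_translation_continuous_supp (K : set V) f :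
  open K -> (mu K < +oo)%E -> (forall x, ~ K x -> f x = 0) ->
  mu.-integrable setT (EFin \o f) -> tcont f.
Proof.
move=> oK Koo f0 fi; have [g [gi _ gc]] := approximation_sfun_integrable measurableT fi.
have mf := integrable_measurable fi.
have mg N : measurable_fun setT (g N) by exact: measurable_funP.
apply: L1_translation_continuous_approx => // e e0.
have [N _ /(_ N (leqnn N)) HN] := cvge0_near_le gc e0.
exists (fun x => g N x * \1_K x); first exact: L1_translation_continuous_sfun.
apply: le_trans HN; apply: ge0_le_integral => //.
- apply/measurable_EFinP; apply: measurableT_comp => //; apply: measurable_funB => //.
  by apply: measurable_funM => //; apply: measurable_indic; exact: open_measurable_rV.
- by apply/measurable_EFinP; apply: measurableT_comp => //; exact: measurable_funB.
move=> x _; rewrite lee_fin indicE; have [xK|/f0 ->] := pselect (K x).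
  by rewrite mem_set // mulr1.
by case: (x \in K); rewrite ?mulr1 // mulr0 subrr normr0.
Qed.

Definition correlation (G h : V -> R) (z : V) : R := \int[mu]_x (G x * h (x + z)).

Lemma le_correlationB (G h : V -> R) z :
  mu.-integrable setT (EFin \o (fun x => G x * h (x + z))) ->
  mu.-integrable setT (EFin \o (fun x => G x * h x)) ->
  (`|correlation G h z - correlation G h 0|%:E <=
   \int[mu]_x (`|G x| * `|h (x + z)%R - h x|)%:E)%E.
Proof.
move=> i1 i2; rewrite /correlation; under [X in _ - X]eq_Rintegral do rewrite addr0.
rewrite -RintegralB //.
rewrite (_ : (fun x => (G x * h (x + z) - G x * h x)) = (fun x => G x * (h (x + z) - h x))); last first.
  by apply/funext => x; rewrite mulrBr.
have i3 : mu.-integrable setT (EFin \o (fun x => G x * (h (x + z) - h x))).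
  apply: (eq_integrable _ (fun x => (G x * h (x + z))%:E - (G x * h x)%:E)%E) => //.
    by move=> x _ /=; rewrite mulrBr.
  exact: integrableB.
apply: (@le_trans _ _ (\int[mu]_x `|G x * (h (x + z) - h x)|)%:E).
  by rewrite lee_fin; exact: le_normr_Rintegral.
rewrite /Rintegral fineK; first by under eq_integral do rewrite normrM.
by apply: integrable_fin_num => //; exact: (integrable_abse i3).
Qed.

(** Meant for h = f, a sum of products of two L2 functions and therefore no better than L1. *)
Lemma correlation_cvg_bounded (G h : V -> R) (C : R) : measurable_fun setT G ->
  (forall x, `|G x| <= C) -> tcont h ->
  (fun k => correlation G h (z_ k)) @ \oo --> correlation G h 0.
Proof.
move=> mG GC [hi hc].
have C0 : 0 <= C by apply: le_trans (GC 0).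
have bi f : mu.-integrable setT (EFin \o f) -> mu.-integrable setT (EFin \o (fun x => G x * f x)).
  move=> fi; have mf := integrable_measurable fi.
  apply: (le_integrable _ _ _ (integrableZl measurableT C fi)) => //.
    by apply/measurable_EFinP; exact: measurable_funM.
  by move=> x _ /=; rewrite lee_fin !normrM ler_wpM2r // (ger0_norm C0).
apply/cvgrPdist_le => e e0.
have e1 : 0 < e / (C + 1) by rewrite divr_gt0 // ltr_wpDl.
apply: filterS (hc _ e1) => k hk.
rewrite distrC -lee_fin; apply: (le_trans (le_correlationB _ _)) => //.
- by apply: bi; exact: integrable_rV_shift.
- exact: bi.
have mhk := measurable_norm_shiftB (z_ k) (integrable_measurable hi).
apply: (@le_trans _ _ (C%:E * translation_dist h (z_ k))%E).
  rewrite -ge0_integralZl//=.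
  apply: ge0_le_integral => //=.
  - apply/measurable_EFinP; apply: measurable_funM; first exact: measurableT_comp.
    exact/measurable_EFinP.
  - exact: measurable_funeM.
  - by move=> x _; rewrite -EFinM lee_fin ler_wpM2r.
apply: (@le_trans _ _ (C%:E * (e / (C + 1))%:E)%E); first exact: lee_wpmul2l.
by rewrite -EFinM lee_fin mulrCA ler_piMr ?(ltW e0)// ler_pdivrMr ?mul1r ?lerDl// ltr_wpDl.
Qed.

Let sqr_tail (G : V -> R) (M : R) : V -> R := fun x => if M < `|G x| then G x ^+ 2 else 0.

Let measurable_sqr_tail (G : V -> R) M : measurable_fun setT G ->
  measurable_fun setT (sqr_tail G M).
Proof.
move=> mG; apply: measurable_fun_ifT => //; last exact: measurable_funX.
by apply: measurable_fun_ltr => //; exact: measurableT_comp.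
Qed.

Let sqr_tail_cvg (G : V -> R) : measurable_fun setT G ->
  mu.-integrable setT (EFin \o (fun x => G x ^+ 2)) ->
  (fun k : nat => \int[mu]_x (sqr_tail G k%:R x)%:E)%E @ \oo --> 0%E.
Proof.
move=> mG G2.
have [||_ _] := @dominated_convergence _ _ _ mu setT measurableT
  (fun k x => (sqr_tail G k%:R x)%:E) (cst 0%E) _
  (fun k => (measurable_EFinP _ _).2 (measurable_sqr_tail k%:R mG)) (measurable_cst _) _ G2 _.
- apply: aeW => x _; apply: (@cvg_near_cst _ _ 0%E).
  exists (Num.truncn `|G x|).+1 => // k /= kG; rewrite /sqr_tail ltNge.
  rewrite (_ : _ <= _) //.
  by rewrite ltW // (lt_le_trans (truncnS_gt _)) // ler_nat.
- apply: aeW => x k _; rewrite gee0_abs lee_fin /sqr_tail; case: ifP => //; by rewrite sqr_ge0.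
by rewrite integral0.
Qed.

(** Where |G| <= M, continuity of translations in L1 suffices. On the rest, a weighted Young
    inequality leaves the tail of the integral of G^2, small for large M, and a small multiple of
    the integral of h^2, which translations do not change. Continuity of translations in L2 is thus
    avoided. *)
Lemma correlation_cvg_L2 (G h : V -> R) : measurable_fun setT G ->
  mu.-integrable setT (EFin \o (fun x => G x ^+ 2)) -> tcont h ->
  mu.-integrable setT (EFin \o (fun x => h x ^+ 2)) ->
  (fun k => correlation G h (z_ k)) @ \oo --> correlation G h 0.
Proof.
move=> mG G2 [hi hc] h2.
have mh := integrable_measurable hi.
(* Young's inequality with a free weight; the sharp constant is not sought. *)
have mulle (p q a b : R) : 0 <= b -> a * b = 1 -> p * q <= a * p ^+ 2 + b * q ^+ 2.
  move=> b0 ab; rewrite -subr_ge0.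
  rewrite (_ : _ - _ = b * ((a * p - q / 2) ^+ 2 + 3 / 4 * q ^+ 2)).
    by rewrite mulr_ge0 // addr_ge0 ?sqr_ge0 // mulr_ge0 ?sqr_ge0 // divr_ge0.
  transitivity ((a * b) * (a * p ^+ 2) - (a * b) * (p * q) + b * q ^+ 2); last by field.
  by rewrite ab; ring.
have bi f : measurable_fun setT f -> mu.-integrable setT (EFin \o (fun x => f x ^+ 2)) ->
    mu.-integrable setT (EFin \o (fun x => G x * f x)).
  move=> mf fi.
  apply: (le_integrable _ _ _ (integrableD measurableT G2 fi)) => //.
    by apply/measurable_EFinP; exact: measurable_funM.
  move=> x _ /=; rewrite lee_fin normrM (ger0_norm (addr_ge0 (sqr_ge0 _) (sqr_ge0 _))).
  by have := mulle `|G x| `|f x| 1 1 ler01 (mulr1 _); rewrite !mul1r !real_normK ?num_real.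
pose H := fine (\int[mu]_x ((h x) ^+ 2)%:E)%E.
have HE : (\int[mu]_x ((h x) ^+ 2)%:E)%E = H%:E.
  by rewrite /H fineK //; exact: integrable_fin_num.
have H0 : 0 <= H by rewrite -lee_fin -HE integral_ge0 // => x _; rewrite lee_fin sqr_ge0.
apply/cvgrPdist_le => e e0.
(* Three errors of size e / 3. Here b is chosen so that 4 b H <= e / 3, with H + 1 because H may be
   0, and a is its inverse; M is then chosen to make a times the tail at most e / 3, and finally k,
   depending on M. *)
pose a := 12 * (H + 1) / e; pose b := e / (12 * (H + 1)).
have H1 : 0 < 12 * (H + 1) by rewrite mulr_gt0 // ltr_wpDl.
have a0 : 0 < a by rewrite divr_gt0.
have b0 : 0 < b by rewrite divr_gt0.
have ab : a * b = 1 by rewrite /a /b; field; rewrite !gt_eqF // ltr_wpDl.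
have e1 : 0 < e / (3 * a) by rewrite divr_gt0 // mulr_gt0.
have [M _ /(_ M (leqnn M)) HM] := cvge0_near_le (sqr_tail_cvg mG G2) e1.
have e2 : 0 < e / (3 * (M%:R + 1)) by rewrite divr_gt0 // mulr_gt0 // ltr_wpDl.
apply: filterS (hc _ e2) => k hk.
rewrite distrC -lee_fin.
have mhz : measurable_fun setT (fun x : V => h (x + z_ k)).
  exact: (measurableT_comp mh (measurable_rV_shift _)).
have h2z : mu.-integrable setT (EFin \o (fun x => h (x + z_ k) ^+ 2)).
  exact: (integrable_rV_shift (z_ k) h2).
apply: (le_trans (le_correlationB _ _)) => //; [exact: bi|exact: bi|].
have mD := measurable_norm_shiftB (z_ k) mh.
have mT := (measurable_EFinP _ _).2 (measurable_sqr_tail M%:R mG).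
have mh2 : measurable_fun setT (fun x => ((h x) ^+ 2)%:E).
  by apply/measurable_EFinP; exact: measurable_funX.
have mh2z : measurable_fun setT (fun x : V => ((h (x + z_ k)) ^+ 2)%:E).
  by apply/measurable_EFinP; exact: measurable_funX.
(* |G(x)| |dh| <= M |dh| + a G(x)^2 1_(|G(x)| > M) + 2 b (h(x+z)^2 + h(x)^2), where
   dh = h(x+z) - h(x) and a b = 1. *)
apply: (@le_trans _ _ (M%:R%:E * translation_dist h (z_ k) +
   (a%:E * \int[mu]_x (sqr_tail G M%:R x)%:E +
    ((2 * b)%:E * H%:E + (2 * b)%:E * H%:E)))%E); last first.
  apply: (@le_trans _ _ (M%:R%:E * (e / (3 * (M%:R + 1)))%:E + (a%:E * (e / (3 * a))%:E +
    ((2 * b)%:E * H%:E + (2 * b)%:E * H%:E)))%E).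
    apply: leeD; first exact: lee_wpmul2l.
    by apply: leeD => //; apply: lee_wpmul2l => //; rewrite lee_fin ltW.
  rewrite -!EFinM -!EFinD lee_fin.
  have -> : a * (e / (3 * a)) = e / 3 by field; rewrite gt_eqF.
  have -> : 2 * b * H = e / 6 * (H / (H + 1)).
    by rewrite /b; field; rewrite gt_eqF // ltr_wpDl.
  have -> : M%:R * (e / (3 * (M%:R + 1))) = e / 3 * (M%:R / (M%:R + 1)).
    by field; rewrite gt_eqF // ltr_wpDl.
  have h1 (r : R) : 0 <= r -> r / (r + 1) <= 1.
    by move=> r0; rewrite ler_pdivrMr ?mul1r ?lerDl // ltr_wpDl.
  have := ler_wpM2l (ltW (divr_gt0 e0 (ltr0Sn R 2))) (h1 M%:R (ler0n _ _)).
  have := ler_wpM2l (ltW (divr_gt0 e0 (ltr0Sn R 5))) (h1 H H0).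
  set x := e / 6 * _; set y := e / 3 * _; lra.
have HzE : (\int[mu]_x ((h (x + z_ k)%R) ^+ 2)%:E)%E = H%:E.
  rewrite -HE; apply: (ge0_integral_rV_shift (z_ k) mh2) => x; rewrite lee_fin; exact: sqr_ge0.
have Zl (c : R) (g : V -> R) : 0 <= c -> (forall x, 0 <= g x) -> measurable_fun setT (fun x => (g x)%:E) ->
    (c%:E * \int[mu]_x (g x)%:E = \int[mu]_x (c * g x)%:E)%E.
  by move=> c0 g0 mg; rewrite -ge0_integralZl// => x _; rewrite lee_fin.
have mZ (c : R) (g : V -> R) : measurable_fun setT (fun x => (g x)%:E) ->
    measurable_fun setT (fun x => (c * g x)%:E).
  by move=> /measurable_EFinP mg; apply/measurable_EFinP; exact: measurable_funM.
have T0 x : 0 <= sqr_tail G M%:R x by rewrite /sqr_tail; case: ifP => // _; exact: sqr_ge0.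
have b20 : 0 <= 2 * b by rewrite mulr_ge0 // ltW.
rewrite -{1}HzE -HE /translation_dist !Zl ?(ltW a0) // => [|x|x]; try exact: sqr_ge0.
rewrite -!ge0_integralD//=.
- apply: ge0_le_integral => //=.
  + apply/measurable_EFinP; apply: measurable_funM; first exact: measurableT_comp.
    exact/measurable_EFinP.
  + apply: emeasurable_funD; first exact: mZ.
    by apply: emeasurable_funD; [|apply: emeasurable_funD]; exact: mZ.
  move=> x _; rewrite -!EFinD lee_fin.
  have MD : 0 <= M%:R * `|h (x + z_ k) - h x| by rewrite mulr_ge0.
  have sz : 0 <= 2 * b * h (x + z_ k) ^+ 2 by rewrite mulr_ge0 // sqr_ge0.
  have s0 : 0 <= 2 * b * h x ^+ 2 by rewrite mulr_ge0 // sqr_ge0.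
  rewrite /sqr_tail; case: ltP => GM.
    apply: (le_trans (mulle _ _ a b (ltW b0) ab)).
    rewrite !real_normK ?num_real //.
    have key : (h (x + z_ k) - h x) ^+ 2 <= 2 * h (x + z_ k) ^+ 2 + 2 * h x ^+ 2.
      rewrite -subr_ge0 (_ : _ - _ = (h (x + z_ k) + h x) ^+ 2); last by ring.
      exact: sqr_ge0.
    have := ler_wpM2l (ltW b0) key; lra.
  rewrite mulr0 add0r -[leLHS]addr0 lerD //; last by rewrite addr_ge0.
  exact: ler_wpM2r.
all: try exact: mZ.
- move=> x _; rewrite adde_ge0 // ?adde_ge0 // lee_fin mulr_ge0 ?sqr_ge0 //.
  exact: ltW.
- by do 2 (apply: emeasurable_funD; first exact: mZ); exact: mZ.
- by move=> x _; rewrite lee_fin mulr_ge0 // ltW.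
- by move=> x _; rewrite adde_ge0 // lee_fin mulr_ge0 // sqr_ge0.
- by apply: emeasurable_funD; exact: mZ.
- by move=> x _; rewrite lee_fin mulr_ge0 // sqr_ge0.
- by move=> x _; rewrite lee_fin mulr_ge0 // sqr_ge0.
Qed.

End sequence.
End translation_continuity.

(** * Averages of correlations, by Fubini *)

Section correlation_Fubini.
Context {R : realType} (n : nat).
Local Notation V := 'rV[R]_n.
Local Notation mu := (lebesgue_rV n : {sigma_finite_measure set V -> \bar R}).
Variables (G h rho : V -> R) (C : R).
Hypothesis Gi : mu.-integrable setT (EFin \o G).
Hypothesis hi : mu.-integrable setT (EFin \o h).
Hypothesis mrho : measurable_fun setT rho.
Hypothesis rhoC : forall z, `|rho z| <= C.
(** Fubini would give this for almost every z only. Required for all z, it makes [correlation G h z]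
    the true inner integral everywhere, never the default value of [fine] at infinity. *)
Hypothesis Ghi : forall z, mu.-integrable setT (EFin \o (fun x : V => G x * h (x + z))).

Let f (p : V * V) : R := rho p.1 * (G p.2 * h (p.2 + p.1)).

Let mG : measurable_fun setT G. Proof. by apply/measurable_EFinP; apply: measurable_int; eassumption. Qed.
Let mh : measurable_fun setT h. Proof. by apply/measurable_EFinP; apply: measurable_int; eassumption. Qed.

Let mf : measurable_fun setT (EFin \o f).
Proof.
apply/measurable_EFinP; apply: measurable_funM.
  exact: (measurableT_comp mrho measurable_fst).
apply: measurable_funM; first exact: (measurableT_comp (f := G) mG measurable_snd).
apply: (measurableT_comp mh); apply: measurable_fun_rV => i.
rewrite (_ : (fun _ => _) = (fun p : V * V => p.2 ord0 i + p.1 ord0 i)); last first.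
  by apply/funext => p; rewrite mxE.
apply: measurable_funD.
  exact: (@measurableT_comp _ _ _ _ _ _ (fun v : V => v ord0 i) _ snd
    (measurable_coord i) measurable_snd).
exact: (@measurableT_comp _ _ _ _ _ _ (fun v : V => v ord0 i) _ fst
  (measurable_coord i) measurable_fst).
Qed.

Let hshift_integrable x : mu.-integrable setT (EFin \o (fun z : V => h (z + x) * rho z)).
Proof.
apply: (le_integrable _ _ _ (integrableZl measurableT C (integrable_rV_shift x hi))) => //.
  apply/measurable_EFinP; apply: measurable_funM => //.
  exact: (measurableT_comp mh (measurable_rV_shift _)).
move=> z _ /=; rewrite lee_fin mulrC !normrM ler_wpM2r //.
exact: le_trans (rhoC z) (ler_norm _).
Qed.

(** Integrating in z first, a shift turns h(x + z) into h, so the double integral of |f| is at most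
    C times the product of the L1 norms of G and h. *)
Let fi : (mu \x mu)%E.-integrable setT (EFin \o f).
Proof.
apply/(integrable21ltyP mu mu mf).
have H : (\int[mu]_x `|h x|%:E < +oo)%E by have /integrableP[] := hi.
have C0 : 0 <= C by apply: le_trans (rhoC 0).
have mnh : measurable_fun setT (fun x => `|h x|%:E).
  by apply/measurable_EFinP; exact: measurableT_comp.
have mnG : measurable_fun setT (fun x => `|G x|%:E).
  by apply/measurable_EFinP; exact: measurableT_comp.
apply: (@le_lt_trans _ _ (\int[mu]_x ((C%:E * \int[mu]_y `|h y|%:E) * `|G x|%:E))%E); last first.
  rewrite ge0_integralZl//; last by rewrite mule_ge0 // integral_ge0.
  have HG : (\int[mu]_x `|G x|%:E < +oo)%E by have /integrableP[] := Gi.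
  rewrite lte_mul_pinfty // ?mule_ge0 ?integral_ge0 //.
  by rewrite fin_numM // ge0_fin_numE // integral_ge0.
apply: ge0_le_integral => //.
- by move=> x _; exact: integral_ge0.
- apply: (measurable_fun_fubini_tonelli_G (abse \o (EFin \o f))) => //=.
  exact: measurableT_comp.
- exact: measurable_funeM.
move=> x _.
have mz := measurable_rV_shift x.
apply: (@le_trans _ _ (\int[mu]_z ((C%:E * `|G x|%:E) * `|h (z + x)%R|%:E))%E).
  apply: ge0_le_integral => //.
  - apply: measurableT_comp => //.
    exact: (measurableT_comp mf (measurable_pair2 _)).
  - by apply: measurable_funeM; exact: (measurableT_comp mnh mz).
  move=> z _; rewrite -!EFinM lee_fin /f /= !normrM addrC -mulrA.
  by rewrite ler_wpM2r // mulr_ge0.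
rewrite ge0_integralZl//; last 2 first.
- exact: (measurableT_comp mnh mz).
- by rewrite -EFinM lee_fin mulr_ge0.
have -> := ge0_integral_rV_shift x mnh (fun x => ltac:(by rewrite lee_fin)).
by rewrite muleAC.
Qed.

Lemma integrable_correlation :
  mu.-integrable setT (EFin \o (fun z => rho z * correlation G h z)).
Proof.
apply: (eq_integrable _ (fubini_F mu (EFin \o f))) => //; last exact: (integrable_fubini_F fi).
move=> z _; rewrite /fubini_F /= /f /=.
rewrite EFinM /correlation /Rintegral fineK; last by apply: integrable_fin_num => //; exact: Ghi.
by rewrite -integralZl //; exact: Ghi.
Qed.

(** Exchange the integrals and substitute y = x + z. For a reflected weight, [rho z = kappa (- z)],
    the inner integral is the convolution of h with kappa at x. *)
Lemma integral_correlation :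
  \int[mu]_z (rho z * correlation G h z) =
  \int[mu]_x (G x * \int[mu]_y (h y * rho (y - x))).
Proof.
suff : (\int[mu]_z (rho z * correlation G h z)%:E =
    \int[mu]_x (G x * \int[mu]_y (h y * rho (y - x)))%R%:E)%E by move/(congr1 fine).
transitivity (\int[mu]_z \int[mu]_x (f (z, x))%:E)%E.
  apply: eq_integral => z _ /=; rewrite /f /=.
  rewrite EFinM /correlation /Rintegral fineK; last by apply: integrable_fin_num => //; exact: Ghi.
  by rewrite -integralZl //; exact: Ghi.
rewrite (Fubini fi); apply: eq_integral => x _.
have E : \int[mu]_y (h y * rho (y - x)) = \int[mu]_z (h (z + x) * rho z).
  have /(integral_rV_shift (- x)) := hshift_integrable x.
  by rewrite /=; under eq_Rintegral do rewrite subrK.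
rewrite E EFinM /Rintegral fineK; last by apply: integrable_fin_num => //; exact: hshift_integrable.
rewrite -integralZl //; last exact: hshift_integrable.
apply: eq_integral => z _.
by rewrite /f /= -EFinM addrC; congr EFin; ring.
Qed.

End correlation_Fubini.

(** * Smooth functions *)

Section smooth_functions.
Context {R : realType} {n : nat}.
Local Notation V := 'rV[R]_n.
Implicit Types (f g : V -> R) (i j : 'I_n) (x y : V).

Lemma is_derive_cvgP f (x v : V) (l : R) :
  is_derive x v f l <-> (fun h : R => h^-1 * (f (h *: v + x) - f x)) @ 0^' --> l.
Proof.
split=> [[df <-]|fl]; first exact: df.
by split; [apply/cvg_ex; exists l|exact/cvg_lim].
Qed.

Lemma is_derive_line f (x v : V) (s l : R) : is_derive (s *: v + x) v f l ->
  is_derive s (1 : R) (fun t : R => f (t *: v + x)) l.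
Proof.
move=> /is_derive_cvgP fl.
have E : (fun h : R => h^-1 *: (f ((h *: (1:R) + s) *: v + x) - f (s *: v + x))) @ 0^' --> l.
  rewrite (_ : (fun h : R => _) =
    (fun h : R => h^-1 * (f (h *: v + (s *: v + x)) - f (s *: v + x)))) //.
  by apply/funext => h; rewrite [h *: (1 : R)]mulr1 scalerDl addrA.
by split; [apply/cvg_ex; exists l|exact/cvg_lim].
Qed.

Lemma partial_MVT f i x (h : R) : (forall y, derivable f y 'e_i) -> h != 0 ->
  exists2 c : R, `|c| < `|h| & f (h *: 'e_i + x) - f x = h * partial i f (c *: 'e_i + x).
Proof.
move=> df h0.
pose g t := f (t *: 'e_i + x).
have dg s : is_derive s (1 : R) g (partial i f (s *: 'e_i + x)).
  by apply: is_derive_line; apply: derivableP.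
have cg a b : {within `[a, b], continuous g}.
  by apply: continuous_subspaceT => s; apply/differentiable_continuous/derivable1_diffP.
have g0 : g 0 = f x by rewrite /g scale0r add0r.
have [hlt|hgt|] := ltgtP h 0; last by move=> /eqP; rewrite (negbTE h0).
- have [c + E] := MVT hlt (fun s _ => dg s) (cg _ _).
  rewrite in_itv/= => /andP[hc c0]; exists c; first by rewrite !ltr0_norm // ltrN2.
  by rewrite -[LHS]opprB -[f x]g0 E; ring.
- have [c + E] := MVT hgt (fun s _ => dg s) (cg _ _).
  rewrite in_itv/= => /andP[c0 hc]; exists c; first by rewrite !gtr0_norm.
  by rewrite -[f x]g0 -/(g h) E; ring.
Qed.

Lemma smooth_continuous f : smooth f -> continuous f.
Proof. by move=> sf; have [] := sf [::]. Qed.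

Lemma smooth_derivable f i x : smooth f -> derivable f x 'e_i.
Proof. by move=> sf; have [_] := sf [::]; exact. Qed.

Lemma smooth_partial f i : smooth f -> smooth (partial i f).
Proof. by move=> sf s; have := sf (rcons s i); rewrite /partials foldr_rcons. Qed.

(** A coinduction principle: peeling off the innermost derivative of an iterated one stays inside P,
    so smoothness follows from first-order facts about a class stable under [partial]. *)
Lemma smooth_invariant (P : (V -> R) -> Prop) :
  (forall f, P f -> [/\ continuous f, forall i x, derivable f x 'e_i &
     forall i, P (partial i f)]) ->
  forall f, P f -> smooth f.
Proof.
move=> H f Pf s; elim/last_ind: s f Pf => [|s i IH] f Pf.
  by have [] := H f Pf.
by rewrite /partials foldr_rcons; apply: IH; have [_ _] := H f Pf; exact.
Qed.

Lemma partialD f g i : (forall x, derivable f x 'e_i) -> (forall x, derivable g x 'e_i) ->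
  partial i (fun x => f x + g x) = (fun x => partial i f x + partial i g x).
Proof. by move=> df dg; apply/funext => x; exact: deriveD. Qed.

Lemma partialM f g i : (forall x, derivable f x 'e_i) -> (forall x, derivable g x 'e_i) ->
  partial i (fun x => f x * g x) = (fun x => f x * partial i g x + g x * partial i f x).
Proof. by move=> df dg; apply/funext => x; exact: deriveM. Qed.

(* Unlike the products of two smooth functions, this class is stable under partial
   derivatives, as [smooth_invariant] requires. *)
Inductive smooth_gen : (V -> R) -> Prop :=
| smooth_gen_base f : smooth f -> smooth_gen f
| smooth_genD f g : smooth_gen f -> smooth_gen g -> smooth_gen (fun x => f x + g x)
| smooth_genM f g : smooth_gen f -> smooth_gen g -> smooth_gen (fun x => f x * g x).

Lemma smooth_gen_smooth f : smooth_gen f -> smooth f.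
Proof.
apply: smooth_invariant => {}f; elim => {f} [f sf|f g _ [cf df pf] _ [cg dg pg]|f g sf [cf df pf] sg [cg dg pg]].
- split; [exact: smooth_continuous|by move=> i x; exact: smooth_derivable|].
  by move=> i; apply: smooth_gen_base; exact: smooth_partial.
- split=> [x|i x|i]; [exact: cvgD (cf x) (cg x)|exact: derivableD|].
  by rewrite partialD //; exact: smooth_genD.
- split=> [x|i x|i]; [exact: cvgM (cf x) (cg x)|exact: derivableM|].
  by rewrite partialM //; apply: smooth_genD; exact: smooth_genM.
Qed.

Lemma smoothM f g : smooth f -> smooth g -> smooth (fun x => f x * g x).
Proof.
by move=> sf sg; apply/smooth_gen_smooth/smooth_genM; exact: smooth_gen_base.
Qed.

Lemma is_derive_affine f (a : R) (b x v : V) (l : R) : a != 0 ->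
  is_derive (a *: x + b) v f l ->
  is_derive x v (fun y => f (a *: y + b)) (a * l).
Proof.
move=> a0 /is_derive_cvgP fl; apply/is_derive_cvgP.
have -> : (fun h : R => h^-1 * (f (a *: (h *: v + x) + b) - f (a *: x + b))) =
   (fun h => a * ((fun h => h^-1 * (f (h *: v + (a *: x + b)) - f (a *: x + b))) (a * h))).
  apply/funext => h /=; rewrite scalerDr scalerA addrA invfM !mulrA mulfV // mul1r.
  by [].
apply: cvgMl_tmp.
apply: (cvg_comp (fun h => a * h) _ _ fl).
move=> U [e /= e0 eU]; exists (e / `|a|); first by rewrite /= divr_gt0 // normr_gt0.
move=> h /=; rewrite sub0r normrN => he h0; apply: eU; last by rewrite mulf_neq0.
by rewrite /= sub0r normrN normrM mulrC -ltr_pdivlMr // normr_gt0.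
Qed.

Lemma partial_affine f (a : R) (b : V) i : a != 0 -> (forall x, derivable f x 'e_i) ->
  partial i (fun x => f (a *: x + b)) = (fun x => a * partial i f (a *: x + b)).
Proof.
move=> a0 df; apply/funext => x.
by have [_] := is_derive_affine a0 (derivableP (df (a *: x + b))).
Qed.

Lemma smooth_cst (c : R) : smooth (fun _ : V => c).
Proof.
apply: (smooth_invariant (P := fun f => exists c, f = cst c)); last by exists c.
move=> _ [{}c ->]; split => [|i x|i]; [exact: cst_continuous|exact: derivable_cst|].
by exists 0; apply/funext => x; exact: derive_cst.
Qed.

Lemma affine_continuous (a : R) (b : V) : continuous (fun x : V => a *: x + b).
Proof.
move=> x.
have h1 : {for x, continuous (fun x : V => a *: x)} by exact: scaler_continuous.
have h2 : {for x, continuous (fun _ : V => b)} by exact: cst_continuous.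
exact: continuousD h1 h2.
Qed.

Lemma smooth_affine f (a : R) (b : V) : a != 0 -> smooth f ->
  smooth (fun x => f (a *: x + b)).
Proof.
move=> a0 sf.
(* The factor c is there because every derivative brings out a factor a. *)
apply: (smooth_invariant (P := fun g => exists c f, smooth f /\ g = (fun x => c * f (a *: x + b)))).
  move=> _ [c [{sf} {}f [sf ->]]].
  have df i y : derivable f y 'e_i by exact: smooth_derivable.
  have ca : continuous (fun x => f (a *: x + b)).
    move=> x; apply: (@continuous_comp _ _ _ (fun x => a *: x + b) f).
      exact: affine_continuous.
    exact: smooth_continuous.
  have da i x : derivable (fun x => f (a *: x + b)) x 'e_i.
    by have [] := is_derive_affine a0 (derivableP (df i (a *: x + b))).
  split => [x|i x|i].
  - have h1 : {for x, continuous (fun _ : V => c)} by exact: cst_continuous.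
    exact: continuousM h1 (ca x).
  - by apply: derivableM => //; exact: derivable_cst.
  - exists (c * a), (partial i f); split; first exact: smooth_partial.
    rewrite partialM //.
    apply/funext => x; rewrite partial_affine //.
    by rewrite [partial i (fun _ => c) x]derive_cst mulr0 addr0 mulrA.
by exists 1, f; split => //; apply/funext => x; rewrite mul1r.
Qed.

End smooth_functions.

(** * Symmetry of second derivatives *)

Section second_derivatives.
Context {R : realType} {n : nat}.
Local Notation V := 'rV[R]_n.
Implicit Types (f g : V -> R) (i j : 'I_n) (x y : V).

Lemma continuous_rVP f : continuous f <-> forall x (e : R), 0 < e ->
  exists2 d : R, 0 < d & forall y, (forall i, `|y ord0 i - x ord0 i| < d) -> `|f y - f x| < e.
Proof.
split=> [cf x e e0|H x].
  have /cvgrPdist_lt/(_ e e0)/nbhs_ballP[d /= d0 dH] := cf x.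
  exists d => // y xy; rewrite distrC; apply: dH; split => // a j.
  by rewrite ord1 /ball/= distrC.
have FF : Filter (nbhs x) := nbhs_filter x.
apply/(@cvgrPdist_lt _ _ _ (nbhs x) FF) => e e0; have [d d0 dH] := H x e e0.
apply/nbhs_ballP; exists d => //= y [_ xy]; rewrite distrC; apply: dH => i.
by have := xy ord0 i; rewrite /ball/= distrC.
Qed.

(* Both orders of differentiation are values of the same second difference of f
   along e_i and e_j, by two applications of the mean value theorem. *)
Lemma partialC f i j : smooth f -> partial i (partial j f) = partial j (partial i f).
Proof.
move=> sf; apply/funext => x.
(* The two mean value points move by less than d along e_k and along e_l; the bound is 2 * d because
   k and l may coincide. *)
have key k l : forall d : R, 0 < d -> exists y : V,
    (forall i, `|y ord0 i - x ord0 i| < 2 * d) /\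
    f (d *: 'e_k + (d *: 'e_l + x)) - f (d *: 'e_k + x) - (f (d *: 'e_l + x) - f x)
      = d * (d * partial l (partial k f) y).
  move=> d d0.
  pose g (y : V) := f (y + d *: 'e_l) - f y.
  have df a y : derivable f y 'e_a by exact: smooth_derivable.
  have dfs a y : derivable (fun y => f (y + d *: 'e_l)) y 'e_a.
    have := is_derive_affine (b := d *: 'e_l) (oner_neq0 R) (derivableP (df a (1 *: y + d *: 'e_l))).
    by under eq_fun do rewrite scale1r; case.
  have dg y : derivable g y 'e_k by apply: derivableB.
  have [c cd E] := partial_MVT x dg (lt0r_neq0 d0).
  have gk : partial k g = fun y => partial k f (y + d *: 'e_l) - partial k f y.
    apply/funext => y; rewrite /partial deriveB //.
    have := partial_affine (d *: 'e_l) (oner_neq0 R) (df k).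
    move=> /(congr1 (fun h => h y)); rewrite mul1r scale1r /partial => <-.
    by under [in RHS]eq_fun do rewrite scale1r.
  have [c' c'd E'] := @partial_MVT _ _ (partial k f) l (c *: 'e_k + x) d
    (fun y => smooth_derivable (smooth_partial k sf)) (lt0r_neq0 d0).
  exists (c' *: 'e_l + (c *: 'e_k + x)); split.
    move=> a; rewrite !mxE eqxx /= addrA addrK.
    rewrite (le_lt_trans (ler_normD _ _)) // !normrM.
    rewrite (gtr0_norm d0) in cd c'd.
    have h (p : R) (b : bool) : `|p| < d -> `|p| * `|b%:R : R| < d.
      by case: b; rewrite ?normr1 ?mulr1 // normr0 mulr0.
    rewrite (_ : 2 * d = d + d); last by ring.
    by rewrite ltrD //; exact: h.
  rewrite -E'.
  transitivity (g (d *: 'e_k + x) - g x); last first.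
    rewrite E gk; congr (_ * (partial k f _ - _)); first by rewrite addrC.
  rewrite /g (addrC x) (addrC _ (d *: 'e_l)) addrCA; ring.
(* The two mixed derivatives are evaluated at different points y and z; continuity at x brings them
   together as d tends to 0. *)
have clos (p q : V -> R) : continuous p -> continuous q ->
    (forall d : R, 0 < d -> exists y z : V, [/\ (forall i, `|y ord0 i - x ord0 i| < 2 * d),
        (forall i, `|z ord0 i - x ord0 i| < 2 * d) & p y = q z]) -> p x = q x.
  move=> cp cq H; apply/eqP; rewrite -subr_eq0 -normr_le0; apply/ler_addgt0Pl => e e0.
  have e2 : 0 < e / 2 by rewrite divr_gt0.
  have [d1 d10 H1] := (continuous_rVP p).1 cp x _ e2.
  have [d2 d20 H2] := (continuous_rVP q).1 cq x _ e2.
  pose d := Num.min d1 d2 / 2.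
  have dm : 0 < Num.min d1 d2 by rewrite lt_min d10.
  have [y [z [yx zx E]]] := H d (divr_gt0 dm (ltr0Sn R 1)).
  have dE : 2 * d = Num.min d1 d2 by rewrite /d mulrC divfK.
  have py : `|p y - p x| < e / 2.
    by apply: H1 => a; apply: (lt_le_trans (yx a)); rewrite dE ge_min lexx.
  have qz : `|q z - q x| < e / 2.
    by apply: H2 => a; apply: (lt_le_trans (zx a)); rewrite dE ge_min lexx orbT.
  rewrite addr0 (_ : p x - q x = (q z - q x) - (p y - p x)); last by rewrite E; ring.
  by rewrite (le_trans (ler_normB _ _)) // [e]splitr lerD // ltW.
apply: clos.
- by apply/smooth_continuous/smooth_partial/smooth_partial.
- by apply/smooth_continuous/smooth_partial/smooth_partial.
move=> d d0; have [y [yx Ey]] := key j i d d0; have [z [zx Ez]] := key i j d d0.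
exists y, z; split; [exact: yx|exact: zx|].
have cancel2 (p q r t : R) : r = d * (d * p) -> t = d * (d * q) -> r = t -> p = q.
  by move=> -> -> h; do 2 apply: (mulfI (lt0r_neq0 d0)).
apply: (cancel2 _ _ _ _ Ey Ez); rewrite addrCA; ring.
Qed.

End second_derivatives.

(** * Compact support and convolution *)

Section convolution.
Context {R : realType} {n : nat}.
Local Notation V := 'rV[R]_n.
Local Notation mu := (lebesgue_rV n : {sigma_finite_measure set V -> \bar R}).
Implicit Types (f g h : V -> R) (i j : 'I_n) (x y : V).

Definition compactly_supported f : Prop := compact (closure [set x | f x != 0]).

Lemma support_sub_compact f (K : set V) : compact K -> closed K ->
  (forall x, f x != 0 -> K x) -> compactly_supported f.
Proof.
move=> cK clK fK; apply: (subclosed_compact _ cK); first exact: closed_closure.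
by rewrite closureE => x; apply; split.
Qed.

Lemma notin_closure_near (A : set V) x : ~ closure A x -> \forall y \near x, ~ A y.
Proof.
move=> nA; have : nbhs x (~` closure A).
  by apply: open_nbhs_nbhs; split => //; apply: closed_openC; exact: closed_closure.
by apply: filterS => y nAy Ay; apply: nAy; exact: subset_closure.
Qed.

Lemma partial_support f i x : partial i f x != 0 -> closure [set y | f y != 0] x.
Proof.
move=> fx; apply: contrapT => /notin_closure_near fy.
case/eqP: fx; apply: cvg_lim => //.
apply: (@cvg_near_cst _ _ (0 : R)).
have h1 : {for 0, continuous (fun h : R => h *: ('e_i : V))} by exact: scalel_continuous.
have h2 : {for 0, continuous (fun _ : R => x)} by exact: cst_continuous.
have line : (fun h : R => h *: 'e_i + x) @ 0 --> (0 *: ('e_i : V) + x) := continuousD h1 h2.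
rewrite scale0r add0r in line.
have := nbhs_dnbhs (line _ fy).
apply: filterS => h /negP; rewrite negbK => /eqP /= ->.
have /= /negP := nbhs_singleton fy; rewrite negbK => /eqP ->.
by rewrite subrr scaler0.
Qed.

Lemma compactly_supported_partial f i : compactly_supported f ->
  compactly_supported (partial i f).
Proof.
move=> cf; apply: (support_sub_compact cf); first exact: closed_closure.
by move=> x; exact: partial_support.
Qed.

Lemma compactly_supported_bounded f : continuous f -> compactly_supported f ->
  exists2 C : R, 0 <= C & forall x, `|f x| <= C.
Proof.
move=> cf sf; have [f0|/existsNP[x0 fx0]] := pselect (forall x, f x = 0).
  by exists 0 => // x; rewrite f0 normr0.
have x0K : closure [set x | f x != 0] x0.
  by apply: subset_closure; apply/eqP.
have cn : {within closure [set x | f x != 0], continuous (fun x => `|f x|)}.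
  apply: continuous_subspaceT => x.
  exact: (continuous_comp (cf x) (@norm_continuous _ _ _)).
have [c _ cmax] := compact_EVT_max (ex_intro _ x0 x0K) sf cn.
exists `|f c| => // x; have [fx|fx] := eqVneq (f x) 0; first by rewrite fx normr0.
by apply: cmax; apply/mem_set/subset_closure.
Qed.

(** Heine-Cantor on the compact support handles x in the support. If f x = 0 but f y <> 0, exchange
    x and y; if both vanish there is nothing to show. *)
Lemma compactly_supported_unif f : continuous f -> compactly_supported f ->
  forall e : R, 0 < e -> exists2 d : R, 0 < d &
    forall x y, (forall i, `|y ord0 i - x ord0 i| < d) -> `|f y - f x| <= e.
Proof.
move=> /continuous_rVP cf sf e e0.
pose P (d : R) (x : V) := forall y, (forall i, `|y ord0 i - x ord0 i| < d) -> `|f y - f x| <= e.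
have : \forall d \near (0 : R)^'+, closure [set x | f x != 0] `<=` P d.
  apply: ((compact_near_coveringP _).1 sf) => x _.
  have [d d0 dH] := cf x _ (divr_gt0 e0 (ltr0Sn R 1)).
  have d2 : 0 < d / 2 by rewrite divr_gt0.
  exists (ball x (d / 2), [set t | 0 < t < d / 2]) => /=.
    split; first exact: nbhsx_ballx.
    by near=> t; apply/andP; split; near: t; [exact: nbhs_right_gt|exact: nbhs_right_lt].
  move=> [x' t] /= [[_ xx'] /andP[t0 td]] y yx'.
  have x'x i : `|x' ord0 i - x ord0 i| < d / 2.
    by have := xx' ord0 i; rewrite /ball/= distrC.
  rewrite (_ : f y - f x' = (f y - f x) - (f x' - f x)); last by ring.
  rewrite (le_trans (ler_normB _ _)) // [e]splitr lerD // ltW //; apply: dH => i.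
    rewrite -(subrKA (x' ord0 i)) (le_lt_trans (ler_normD _ _)) // [d]splitr ltrD //.
    exact: lt_trans (yx' i) td.
  by rewrite (lt_trans (x'x i)) // ltr_pdivrMr // ltr_pMr // ltr1n.
move=> [d /= d0 /(_ (d / 2))] H.
have {}H : closure [set x | f x != 0] `<=` P (d / 2).
  by apply: H; rewrite ?divr_gt0 //= sub0r normrN gtr0_norm ?divr_gt0 // ltr_pdivrMr // ltr_pMr // ltr1n.
exists (d / 2); first by rewrite divr_gt0.
move=> x y xy; have [fx|fx] := eqVneq (f x) 0; last first.
  by apply: H xy; exact: subset_closure.
have [fy|fy] := eqVneq (f y) 0; first by rewrite fx fy subrr normr0 ltW.
rewrite distrC; apply: (H y); first exact: subset_closure.
by move=> i; rewrite distrC.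
Unshelve. all: by end_near. Qed.


Definition convolution h f : V -> R := fun x => \int[mu]_y (h y * f (x - y)).

Section kernel.
Variable h : V -> R.
Hypothesis hi : mu.-integrable setT (EFin \o h).

Let mh : measurable_fun setT h.
Proof. by apply/measurable_EFinP; apply: measurable_int; eassumption. Qed.

Lemma integrable_mul_bounded (f : V -> R) (C : R) : measurable_fun setT f ->
  (forall y, `|f y| <= C) -> mu.-integrable setT (EFin \o (fun y => h y * f y)).
Proof.
move=> mf fC.
apply: (le_integrable _ _ _ (integrableZl measurableT C hi)) => //.
  by apply/measurable_EFinP; exact: measurable_funM.
move=> y _ /=; rewrite lee_fin mulrC !normrM ler_wpM2r //.
exact: le_trans (fC y) (ler_norm _).
Qed.

Lemma le_integral_mul_bounded (f : V -> R) (C : R) : measurable_fun setT f ->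
  (forall y, `|f y| <= C) ->
  `|\int[mu]_y (h y * f y)| <= C * \int[mu]_y `|h y|.
Proof.
move=> mf fC; have hf := integrable_mul_bounded mf fC.
rewrite (le_trans (le_normr_Rintegral _ hf)) // -RintegralZl //; last exact: (integrable_abse hi).
apply: le_Rintegral => //.
- exact: (integrable_abse hf).
- apply: (eq_integrable _ (fun y => C%:E * `|(h y)%:E|)%E) => //.
  by apply: integrableZl => //; exact: (integrable_abse hi).
- by move=> y _; rewrite normrM mulrC ler_wpM2r.
Qed.

Lemma reflect_measurable f x : continuous f -> measurable_fun setT (fun y => f (x - y)).
Proof.
move=> cf; have -> : (fun y => f (x - y)) = (fun y => f ((-1) *: y + x)).
  by apply/funext => y; rewrite scaleN1r addrC.
apply: continuous_measurable_rV => y.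
apply: (@continuous_comp _ _ _ (fun y => (-1) *: y + x) f); last exact: cf.
exact: affine_continuous.
Qed.

Let I := \int[mu]_y `|h y|.
Let I0 : 0 <= I. Proof. exact: Rintegral_ge0. Qed.

Lemma convolution_continuous f : continuous f -> compactly_supported f ->
  continuous (convolution h f).
Proof.
move=> cf sf; apply/continuous_rVP => x e e0.
have [C _ fC] := compactly_supported_bounded cf sf.
have e1 : 0 < e / (2 * (I + 1)) by rewrite divr_gt0 // mulr_gt0 // ltr_wpDl.
have [d d0 dH] := compactly_supported_unif cf sf e1.
exists d => // x' xx'; rewrite /convolution.
have hb z : mu.-integrable setT (EFin \o (fun y => h y * f (z - y))).
  by apply: (integrable_mul_bounded (C := C)) => //; exact: reflect_measurable.
rewrite -RintegralB //; under eq_Rintegral do rewrite -mulrBr.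
apply: (@le_lt_trans _ _ (e / (2 * (I + 1)) * I)).
  apply: le_integral_mul_bounded.
    by apply: measurable_funB; exact: reflect_measurable.
  by move=> y; apply: dH => i; rewrite !mxE opprB addrA subrK.
rewrite (_ : _ * I = e * (I / (2 * (I + 1)))); last by field; rewrite gt_eqF // ltr_wpDl.
rewrite gtr_pMr // ltr_pdivrMr; last by rewrite mulr_gt0 // ltr_wpDl.
by rewrite mul1r; have := I0; lra.
Qed.

(** By the mean value theorem the difference quotient of f is a value of [partial i f] at a nearby
    point. Uniform continuity of [partial i f] then makes the quotients converge uniformly, and h is
    integrable. *)
Lemma is_derive_convolution f i x : smooth f -> compactly_supported f ->
  is_derive x 'e_i (convolution h f) (convolution h (partial i f) x).
Proof.
move=> sf cf; apply/is_derive_cvgP.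
have cts : continuous f by exact: smooth_continuous.
have ctp : continuous (partial i f) by apply/smooth_continuous/smooth_partial.
have csp := @compactly_supported_partial f i cf.
have [C _ fC] := compactly_supported_bounded cts cf.
have [C' _ fC'] := compactly_supported_bounded ctp csp.
have FF : Filter (0 : R)^' := dnbhs_filter _.
apply/cvgrPdist_le => e e0.
have e1 : 0 < e / (I + 1) by rewrite divr_gt0 // ltr_wpDl.
have [d d0 dH] := compactly_supported_unif ctp csp e1.
exists d; first exact: d0.
move=> t /=; rewrite sub0r normrN => td t0.
have hb z : mu.-integrable setT (EFin \o (fun y => h y * f (z - y))).
  by apply: (integrable_mul_bounded (C := C)) => //; exact: reflect_measurable.
have hbp z : mu.-integrable setT (EFin \o (fun y => h y * partial i f (z - y))).
  by apply: (integrable_mul_bounded (C := C')) => //; exact: reflect_measurable.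
rewrite /convolution -RintegralB // -RintegralZl //; last first.
  apply: (eq_integrable _ (fun y => (h y * f (t *: 'e_i + x - y))%:E - (h y * f (x - y))%:E)%E) => //.
  exact: (integrableB measurableT (hb _) (hb _)).
rewrite -RintegralB //; last first.
  apply: (eq_integrable _ (fun y => (t^-1)%:E * ((h y * f (t *: 'e_i + x - y))%:E - (h y * f (x - y))%:E))%E) => //.
  by apply: integrableZl => //; exact: (integrableB measurableT (hb _) (hb _)).
under eq_Rintegral do rewrite -mulrBr mulrCA -mulrBr.
apply: (@le_trans _ _ (e / (I + 1) * I)).
  apply: le_integral_mul_bounded.
    apply: measurable_funB; first exact: reflect_measurable.
    by apply: measurable_funM => //; apply: measurable_funB; exact: reflect_measurable.
  move=> y; rewrite -addrA.
  have [c cd ->] := partial_MVT (x - y) (fun z => smooth_derivable sf (x := z)) t0 (i := i).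
  rewrite mulKf // distrC; apply: dH => a; rewrite !mxE addrK eqxx /= normrM.
  rewrite (le_lt_trans _ (lt_trans cd td)) // ler_piMr //.
  by case: (a == i); rewrite ?normr1 ?normr0.
rewrite (_ : _ * I = e * (I / (I + 1))); last by field; rewrite gt_eqF // ltr_wpDl.
by rewrite ger_pMr // ler_pdivrMr ?mul1r ?lerDl // ltr_wpDl.
Qed.

Lemma partial_convolution f i : smooth f -> compactly_supported f ->
  partial i (convolution h f) = convolution h (partial i f).
Proof. by move=> sf cf; apply/funext => x; have [_] := is_derive_convolution i x sf cf. Qed.

Lemma smooth_convolution f : smooth f -> compactly_supported f ->
  smooth (convolution h f).
Proof.
move=> sf cf.
apply: (smooth_invariant (P := fun g => exists f,
  [/\ smooth f, compactly_supported f & g = convolution h f])); last by exists f.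
move=> _ [{sf cf}f [sf cf ->]]; split.
- by apply: convolution_continuous => //; exact: smooth_continuous.
- by move=> i x; have [] := is_derive_convolution i x sf cf.
move=> i; exists (partial i f); split; first exact: smooth_partial.
- exact: compactly_supported_partial.
- exact: partial_convolution.
Qed.

End kernel.
End convolution.

(** * The unit ball and test functions *)

Section unit_ball_lemmas.
Context {R : realType} {n : nat}.
Local Notation V := 'rV[R]_n.
Local Notation mu := (lebesgue_rV n : {sigma_finite_measure set V -> \bar R}).
Local Notation U := (@unit_ball R n).
Implicit Types (f g p q : V -> R) (x y : V).

Lemma open_unit_ball : open U.
Proof.
rewrite (_ : U = (fun x : V => \sum_i x ord0 i ^+ 2) @^-1` [set t | t < 1]); last by [].
apply: open_comp; last exact: open_lt.
move=> x _; elim: (index_enum _) => [|i s IH].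
  rewrite (_ : (fun _ => _) = cst 0); first exact: cst_continuous.
  by apply/funext => y; rewrite big_nil.
rewrite (_ : (fun _ => _) = (fun y : V => y ord0 i * y ord0 i + \sum_(j <- s) y ord0 j ^+ 2)).
  have cx : {for x, continuous (fun y : V => y ord0 i)} by exact: coord_continuous.
  exact: (continuousD (continuousM cx cx) IH).
by apply/funext => y; rewrite big_cons.
Qed.

Lemma unit_ball_coord x i : U x -> `|x ord0 i| < 1.
Proof.
move=> Ux; rewrite -(ltr_pXn2r (n := 2)) ?nnegrE // expr1n real_normK ?num_real //.
by apply: le_lt_trans Ux; rewrite (bigD1 i) //= lerDl sumr_ge0 // => j _; exact: sqr_ge0.
Qed.

Lemma unit_ball_finite_measure : (mu U < +oo)%E.
Proof.
have ab : forall i, (const_mx (-1) : V) ord0 i <= (const_mx 1 : V) ord0 i.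
  by move=> i; rewrite !mxE; lra.
pose box : set V := [set x | forall i, x ord0 i \in
  `](const_mx (-1) : V) ord0 i, (const_mx 1 : V) ord0 i]].
have boxE : mu box = _ := lebesgue_rV_box ab.
apply: (@le_lt_trans _ _ (mu box)); last by rewrite boxE ltry.
apply: le_measure; rewrite ?inE.
- exact: open_measurable_rV open_unit_ball.
- exact: measurable_rV_box.
- by move=> x Ux i; rewrite !mxE in_itv/=; have := unit_ball_coord i Ux; rewrite ltr_norml => /andP[-> /ltW].
Qed.

Lemma lebesgue_rV_open_gt0 (W : set V) : open W -> W !=set0 -> (0 < mu W)%E.
Proof.
move=> oW [w Ww].
have /nbhs_ballP[e /= e0 eW] : nbhs w W by exact: open_nbhs_nbhs.
have e2 : 0 < e / 2 by rewrite divr_gt0.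
pose a : V := w - const_mx (e / 2); pose b : V := w + const_mx (e / 2).
have ab i : a ord0 i <= b ord0 i by rewrite !mxE; lra.
pose box : set V := [set x | forall i, x ord0 i \in `]a ord0 i, b ord0 i]].
have boxE : mu box = _ := lebesgue_rV_box ab.
apply: (@lt_le_trans _ _ (mu box)).
  rewrite boxE lte_fin prodr_gt0 // => i _.
  by rewrite !mxE; lra.
have boxW : box `<=` W.
  move=> x bx; apply: eW; split => // r i; rewrite ord1 /ball/=.
  have := bx i; rewrite !mxE in_itv/= => /andP[h1 h2].
  by rewrite distrC ltr_distl; apply/andP; split; lra.
apply: le_measure; rewrite ?inE //; last exact: open_measurable_rV.
exact: measurable_rV_box.
Qed.

Lemma ball_integralE f : ball_integral f = \int[mu]_x (f \_ U) x.
Proof. exact: Rintegral_mkcond. Qed.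

Lemma ball_restrictE f x : (f \_ U) x = if x \in U then f x else 0.
Proof. by []. Qed.

Lemma integrable_indic_unit_ball : mu.-integrable setT (EFin \o (\1_U : V -> R)).
Proof.
have mU : measurable U by exact: open_measurable_rV open_unit_ball.
apply/integrableP; split; first by apply/measurable_EFinP; exact: measurable_indic.
rewrite (_ : (fun x => `|_|)%E = (fun x => (\1_U x)%:E)).
  by rewrite integral_indic // setIT; exact: unit_ball_finite_measure.
by apply/funext => x; rewrite /= ger0_norm.
Qed.

(** What an L2 function on the ball becomes when extended by 0. The L1 part is recorded because
    convolution, Fubini and continuity of translations are used in L1. *)
Definition L1_and_L2 p : Prop :=
  [/\ measurable_fun setT p, mu.-integrable setT (EFin \o (fun x => p x ^+ 2)) &
      mu.-integrable setT (EFin \o p)].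

(** Since |t| <= t^2 + 1, integrability follows from the finite measure of the ball. *)
Lemma in_L2P f : in_L2 f -> L1_and_L2 (f \_ U).
Proof.
move=> f2; have i2 := Lfun2_integrable_sqr f2.
have mf : measurable_fun setT (f \_ U) by move: f2 => /andP[]; rewrite inE.
split => //.
apply: (le_integrable _ _ _ (integrableD measurableT i2 integrable_indic_unit_ball)) => //.
  exact/measurable_EFinP.
move=> x _ /=; rewrite lee_fin [leRHS]ger0_norm; last by rewrite addr_ge0 // sqr_ge0.
rewrite ball_restrictE indicE; case: (x \in U); last by rewrite normr0 expr0n addr0.
rewrite -(@real_normK _ (f x)) ?num_real //= -subr_ge0.
set t := `|f x|; rewrite (_ : _ - _ = (t - 1 / 2) ^+ 2 + 3 / 4); last by field.
by rewrite addr_ge0 // ?sqr_ge0 // divr_ge0.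
Qed.

Lemma integrable_mulL2 p q : measurable_fun setT p -> measurable_fun setT q ->
  mu.-integrable setT (EFin \o (fun x => p x ^+ 2)) ->
  mu.-integrable setT (EFin \o (fun x => q x ^+ 2)) ->
  mu.-integrable setT (EFin \o (fun x => p x * q x)).
Proof.
move=> mp mq p2 q2; apply: (le_integrable _ _ _ (integrableD measurableT p2 q2)) => //.
  by apply/measurable_EFinP; exact: measurable_funM.
move=> x _ /=; rewrite lee_fin [leRHS]ger0_norm; last by rewrite addr_ge0 // sqr_ge0.
rewrite normrM -(@real_normK _ (p x)) ?num_real // -(@real_normK _ (q x)) ?num_real //.
rewrite -subr_ge0.
set s := `|p x|; set t := `|q x|; rewrite (_ : _ - _ = (s - t / 2) ^+ 2 + 3 / 4 * t ^+ 2); last by field.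
by rewrite addr_ge0 // ?sqr_ge0 // mulr_ge0 ?divr_ge0 // sqr_ge0.
Qed.

Lemma integrable_sqrD p q : measurable_fun setT p -> measurable_fun setT q ->
  mu.-integrable setT (EFin \o (fun x => p x ^+ 2)) ->
  mu.-integrable setT (EFin \o (fun x => q x ^+ 2)) ->
  mu.-integrable setT (EFin \o (fun x => (p x + q x) ^+ 2)).
Proof.
move=> mp mq p2 q2; apply: (eq_integrable _ (fun x => (p x ^+ 2)%:E +
   (q x ^+ 2)%:E + 2%:E * (p x * q x)%:E)%E) => //.
  by move=> x _ /=; rewrite -EFinM -!EFinD; congr EFin; ring.
apply: integrableD => //; first exact: integrableD.
by apply: integrableZl => //; exact: integrable_mulL2.
Qed.

Lemma integrable_sqr_sum (I : Type) (s : seq I) (F : I -> V -> R) :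
  (forall i, measurable_fun setT (F i)) ->
  (forall i, mu.-integrable setT (EFin \o (fun x => F i x ^+ 2))) ->
  measurable_fun setT (fun x => \sum_(i <- s) F i x) /\
  mu.-integrable setT (EFin \o (fun x => (\sum_(i <- s) F i x) ^+ 2)).
Proof.
move=> mF iF; elim: s => [|i s [IH1 IH2]].
  under eq_fun do rewrite big_nil; split => //.
  apply: (eq_integrable _ (cst 0%E)) => //; last exact: integrable0.
  by move=> x _ /=; rewrite big_nil expr0n.
rewrite (_ : (fun x => _) = (fun x => F i x + \sum_(j <- s) F j x)); last first.
  by apply/funext => x; rewrite big_cons.
split; first exact: measurable_funD.
apply: (eq_integrable _ (EFin \o (fun x => (F i x + \sum_(j <- s) F j x) ^+ 2))) => //.
  by move=> x _ /=; rewrite big_cons.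
exact: integrable_sqrD.
Qed.

Lemma integrable_Rsum (I : Type) (s : seq I) (F : I -> V -> R) :
  (forall i, mu.-integrable setT (EFin \o F i)) ->
  mu.-integrable setT (EFin \o (fun x => \sum_(i <- s) F i x)).
Proof.
move=> iF; apply: (eq_integrable _ (fun x => \sum_(i <- s) (F i x)%:E)%E) => //.
  by move=> x _ /=; rewrite sumEFin.
by apply: integrable_sum => // i _; exact: iF.
Qed.

Lemma Rintegral_sum (I : Type) (s : seq I) (F : I -> V -> R) :
  (forall i, mu.-integrable setT (EFin \o F i)) ->
  \int[mu]_x (\sum_(i <- s) F i x) = \sum_(i <- s) \int[mu]_x F i x.
Proof.
move=> iF; elim: s => [|i s IH].
  by under eq_Rintegral do rewrite big_nil; rewrite /Rintegral integral0 big_nil.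
under eq_Rintegral do rewrite big_cons.
by rewrite big_cons RintegralD // ?IH //; exact: integrable_Rsum.
Qed.

(** Otherwise rho F is nonnegative with integral 0, hence null almost everywhere, yet positive on
    the nonempty open set where rho does not vanish. No measure of concentration or normalisation of
    rho enters. *)
Lemma exists_le0_of_integral0 (rho F : V -> R) : continuous rho ->
  (forall z, 0 <= rho z) -> (exists z, rho z != 0) ->
  mu.-integrable setT (EFin \o (fun z => rho z * F z)) ->
  \int[mu]_z (rho z * F z) = 0 -> exists2 z, rho z != 0 & F z <= 0.
Proof.
move=> crho rho0 [z0 z0P] iF I0; apply: contrapT => nF.
have Fpos z : rho z != 0 -> 0 < F z.
  by move=> rz; rewrite ltNge; apply/negP => Fz; apply: nF; exists z.
have pos z : 0 <= rho z * F z.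
  have [->|rz] := eqVneq (rho z) 0; first by rewrite mul0r.
  by rewrite mulr_ge0 // ltW // Fpos.
have mF : measurable_fun setT (fun z => (rho z * F z)%:E).
  by apply: measurable_int; exact: iF.
have : (\int[mu]_z `|(rho z * F z)%:E| = 0)%E.
  under eq_integral => z _ do rewrite gee0_abs ?lee_fin ?pos //.
  have := congr1 EFin I0; rewrite /Rintegral fineK //.
  by apply: integrable_fin_num.
move=> /(ae_eq_integral_abs mu measurableT mF)[N [mN N0 NP]].
have oW : open (rho @^-1` [set t | t != 0]).
  by apply: open_comp => [x _|]; [exact: crho|exact: open_neq].
have W0 := lebesgue_rV_open_gt0 oW (ex_intro _ z0 z0P).
have WN : rho @^-1` [set t | t != 0] `<=` N.
  move=> z /= rz; apply: NP => /= H.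
  have /eqP : rho z * F z = 0 by have [] := H I.
  by rewrite mulf_eq0 (negPf rz) /= gt_eqF // Fpos.
have : (mu (rho @^-1` [set t | t != 0%R]) <= mu N)%E.
  by apply: le_measure; rewrite ?inE //; exact: open_measurable_rV.
by rewrite N0 leNgt W0.
Qed.

End unit_ball_lemmas.

Section test_functions.
Context {R : realType} {n : nat}.
Local Notation V := 'rV[R]_n.
Local Notation mu := (lebesgue_rV n : {sigma_finite_measure set V -> \bar R}).
Local Notation U := (@unit_ball R n).
Implicit Types (p q : V -> R) (x y : V).

Lemma L1_and_L2_mul_bounded p q (C : R) : L1_and_L2 p -> measurable_fun setT q ->
  (forall x, `|q x| <= C) -> L1_and_L2 (fun x => p x * q x).
Proof.
move=> [mp p2 pi] mq qC; split; first exact: measurable_funM.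
- under eq_fun do rewrite exprMn.
  apply: (integrable_mul_bounded p2 (C := C ^+ 2)) => //; first exact: measurable_funX.
  move=> x; rewrite normrX ler_pXn2r // nnegrE; exact: le_trans (qC x).
- exact: (integrable_mul_bounded pi mq qC).
Qed.

Lemma L1_and_L2D p q : L1_and_L2 p -> L1_and_L2 q -> L1_and_L2 (fun x => p x + q x).
Proof.
move=> [mp p2 pi] [mq q2 qi]; split; first exact: measurable_funD.
- exact: integrable_sqrD.
- by apply: (eq_integrable _ (fun x => (p x)%:E + (q x)%:E)%E) => //; exact: integrableD.
Qed.

Lemma L1_and_L2N p : L1_and_L2 p -> L1_and_L2 (fun x => - p x).
Proof.
move=> [mp p2 pi]; split.
- exact: measurableT_comp.
- by under eq_fun do rewrite sqrrN.
- by apply: (eq_integrable _ (fun x => - (p x)%:E)%E) => //; exact: integrableN.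
Qed.

Lemma L1_and_L2_sum (I : Type) (s : seq I) (F : I -> V -> R) :
  (forall k, L1_and_L2 (F k)) -> L1_and_L2 (fun x => \sum_(k <- s) F k x).
Proof.
move=> HF; have [h1 h2] := @integrable_sqr_sum _ _ _ s F
  (fun k => let: And3 h _ _ := HF k in h) (fun k => let: And3 _ h _ := HF k in h).
split => //; apply: integrable_Rsum => k; by have [] := HF k.
Qed.

Lemma closure_sub_closed (A K : set V) : closed K -> A `<=` K -> closure A `<=` K.
Proof. by move=> clK AK; rewrite closureE => x; apply. Qed.

Lemma test_function_compact (phi : V -> R) : test_function phi -> compactly_supported phi.
Proof. by case. Qed.

Lemma test_function_continuous (phi : V -> R) : test_function phi -> continuous phi.
Proof. by case=> /smooth_continuous. Qed.

Lemma test_function_support (phi chi : V -> R) : smooth phi -> test_function chi ->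
  (forall x, phi x != 0 -> closure [set y | chi y != 0] x) -> test_function phi.
Proof.
move=> sphi [schi cchi chiU] sub; split => //.
  by apply: (support_sub_compact cchi) => //; exact: closed_closure.
move=> x xphi; apply: chiU.
by move: x xphi; apply: closure_sub_closed => //; exact: closed_closure.
Qed.

Lemma test_function_partial (phi : V -> R) i : test_function phi -> test_function (partial i phi).
Proof.
move=> tphi; have [sphi _ _] := tphi; apply: (test_function_support _ tphi).
- exact: smooth_partial.
- by move=> x; exact: partial_support.
Qed.

Lemma integrable_mul_test p (phi : V -> R) : mu.-integrable setT (EFin \o p) ->
  test_function phi -> mu.-integrable setT (EFin \o (fun x => p x * phi x)).
Proof.
move=> pi tphi; have cphi := test_function_continuous tphi.
have [C _ HC] := compactly_supported_bounded cphi (test_function_compact tphi).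
by apply: (integrable_mul_bounded pi (C := C)) => //; exact: continuous_measurable_rV.
Qed.

Lemma test_function_reflect (kappa : V -> R) x : smooth kappa ->
  compactly_supported kappa ->
  (forall y, closure [set w | kappa w != 0] (x - y) -> U y) ->
  test_function (fun y => kappa (x - y)).
Proof.
move=> sk ck H.
have E : (fun y => kappa (x - y)) = (fun y => kappa ((-1) *: y + x)).
  by apply/funext => y; rewrite scaleN1r addrC.
pose K : set V := (fun s => (-1) *: s + x) @` closure [set w | kappa w != 0].
have cK : compact K.
  apply: continuous_compact => //; apply: continuous_subspaceT; exact: affine_continuous.
have clK : closed K by apply: compact_closed => //; exact: norm_hausdorff.
have sub y : kappa (x - y) != 0 -> K y.
  move=> ky; exists (x - y); first exact: subset_closure.
  by rewrite scaleN1r opprB subrK.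
split.
- by rewrite E; apply: smooth_affine => //; rewrite oppr_eq0 oner_eq0.
- exact: (support_sub_compact cK clK sub).
- move=> y yk; have : K y.
    by move: y yk; apply: closure_sub_closed.
  move=> [s sS <-]; apply: H; rewrite scaleN1r opprD opprK addrCA subrr addr0.
  exact: sS.
Qed.

Lemma partial_reflect (kappa : V -> R) i x : smooth kappa ->
  partial i (fun y => kappa (x - y)) = (fun y => - partial i kappa (x - y)).
Proof.
move=> sk.
have E (h : V -> R) : (fun y => h (x - y)) = (fun y => h ((-1) *: y + x)).
  by apply/funext => y; rewrite scaleN1r addrC.
rewrite E partial_affine; [|by rewrite oppr_eq0 oner_eq0|by move=> y; exact: smooth_derivable].
by apply/funext => y; rewrite mulN1r scaleN1r addrC.
Qed.

Lemma partialN (p : V -> R) i : (forall x, derivable p x 'e_i) ->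
  partial i (fun x => - p x) = (fun x => - partial i p x).
Proof. by move=> dp; apply/funext => x; exact: deriveN. Qed.

Lemma laplacian_reflect (kappa : V -> R) x : smooth kappa ->
  laplacian (fun y => kappa (x - y)) = (fun y => laplacian kappa (x - y)).
Proof.
move=> sk; apply/funext => y; apply: eq_bigr => i _.
have si := smooth_partial i sk.
have E (h : V -> R) : (fun y => h (x - y)) = (fun y => h ((-1) *: y + x)).
  by apply/funext => z; rewrite scaleN1r addrC.
have dr z : derivable (fun y => partial i kappa (x - y)) z 'e_i.
  by rewrite E; apply/smooth_derivable/smooth_affine => //; rewrite oppr_eq0 oner_eq0.
by rewrite (partial_reflect i x sk) (partialN dr) (partial_reflect i x si) opprK.
Qed.

Lemma convolution_bounded (h kappa : V -> R) : mu.-integrable setT (EFin \o h) ->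
  continuous kappa -> compactly_supported kappa ->
  exists C : R, forall x, `|convolution h kappa x| <= C.
Proof.
move=> hi ck sk; have [C _ kC] := compactly_supported_bounded ck sk.
exists (C * \int[mu]_y `|h y|) => x.
by apply: le_integral_mul_bounded => //; exact: reflect_measurable.
Qed.

End test_functions.

(** * The conservation law for one component *)

Lemma compact_sub_open {R : realType} {n : nat} (K W : set 'rV[R]_n) :
  compact K -> open W -> K `<=` W ->
  exists2 d : R, 0 < d & forall x y : 'rV[R]_n, K x ->
    (forall i, `|y ord0 i - x ord0 i| <= d) -> W y.
Proof.
move=> cK oW KW.
pose P (d : R) (x : 'rV[R]_n) := forall y : 'rV[R]_n, (forall i, `|y ord0 i - x ord0 i| <= d) -> W y.
have : \forall d \near (0 : R)^'+, K `<=` P d.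
  apply: ((compact_near_coveringP _).1 cK) => x Kx.
  have /nbhs_ballP[d /= d0 dW] : nbhs x W by apply: open_nbhs_nbhs; split => //; exact: KW.
  have d2 : 0 < d / 2 by rewrite divr_gt0.
  exists (ball x (d / 2), [set t | 0 < t < d / 2]) => /=.
    split; first exact: nbhsx_ballx.
    by near=> t; apply/andP; split; near: t; [exact: nbhs_right_gt|exact: nbhs_right_lt].
  move=> [x' t] /= [[_ xx'] /andP[t0 td]] y yx'; apply: dW; split => // r i; rewrite ord1.
  have := xx' ord0 i; rewrite /ball/= => h1.
  rewrite -(subrKA (x' ord0 i)) (le_lt_trans (ler_normD _ _)) // [d]splitr ltrD //.
  by rewrite distrC (le_lt_trans (yx' i)).
move=> [d /= d0 /(_ (d / 2))] H; exists (d / 2); first by rewrite divr_gt0.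
move=> x y Kx yx; apply: (H _ _ x Kx y yx); last by rewrite divr_gt0.
by rewrite /= sub0r normrN gtr0_norm ?divr_gt0 // ltr_pdivrMr // ltr_pMr // ltr1n.
Unshelve. all: by end_near. Qed.

Lemma compact_cube {R : realType} {n : nat} (d : R) :
  compact [set x : 'rV[R]_n | forall i, `|x ord0 i| <= d].
Proof.
have := @rV_compact R n (fun=> `[-d, d]%classic) (fun=> @segment_compact _ _ _).
congr compact; apply/seteqP; split=> x /= h i; have := h i; rewrite /= in_itv /= ler_norml //.
Qed.

Section conservation.
Context {R : realType} {n : nat}.
Local Notation V := 'rV[R]_n.
Local Notation mu := (lebesgue_rV n : {sigma_finite_measure set V -> \bar R}).
Local Notation U := (@unit_ball R n).

(* For fixed i and j, in the notation of the paper: [a] = A^i_j, [u] = u^j, [g] is the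
   weak gradient of u^j, [f] = sum_k Omega^j_k . du^k, [w] = sum_k A^i_k Omega^k_j, and
   [b] are the coefficients of B^i_j; all are extended by 0 outside the ball. *)
Variables (a u f : V -> R) (w g : 'I_n -> V -> R) (b : 'I_n -> 'I_n -> V -> R) (C : R).
Hypothesis aP : L1_and_L2 a.
Hypothesis aC : forall x, `|a x| <= C.
Hypothesis wP : forall l, L1_and_L2 (w l).
Hypothesis bP : forall i l, L1_and_L2 (b i l).
Hypothesis bC : forall i l x, b i l x = - b l i x.
Hypothesis gP : forall l, L1_and_L2 (g l).
Hypothesis g0 : forall l x, ~ U x -> g l x = 0.
Hypothesis uP : L1_and_L2 u.
Hypothesis fi : mu.-integrable setT (EFin \o f).
Hypothesis f0 : forall x, ~ U x -> f x = 0.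
Hypothesis ug : forall l phi, test_function phi ->
  \int[mu]_x (u x * partial l phi x) = - (\int[mu]_x (g l x * phi x)).
Hypothesis uf : forall phi, test_function phi ->
  - (\int[mu]_x (u x * laplacian phi x)) = \int[mu]_x (f x * phi x).
Hypothesis dstar : forall psi : 'I_n -> V -> R, (forall l, test_function (psi l)) ->
  - (\sum_l \int[mu]_x (a x * partial l (psi l) x))
    - (\int[mu]_x (\sum_l w l x * psi l x))
  = - (\int[mu]_x (\sum_i \sum_l b i l x * partial i (psi l) x)).

Variable eta : V -> R.
Hypothesis etaP : test_function eta.

Let L1_of (p : V -> R) : L1_and_L2 p -> mu.-integrable setT (EFin \o p).
Proof. by case. Qed.

Let seta : smooth eta. Proof. by case: etaP. Qed.
Let ceta : continuous eta. Proof. exact: smooth_continuous. Qed.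
Let cpeta i : continuous (partial i eta). Proof. exact/smooth_continuous/smooth_partial. Qed.

(** Everything that multiplies v_l once the test form eta v is inserted in the equation for A, apart
    from the terms with derivatives of v. *)
Definition current l x : R :=
  - (a x * partial l eta x) - eta x * w l x + \sum_i b i l x * partial i eta x.

Lemma current_L1_and_L2 l : L1_and_L2 (current l).
Proof.
have bd i := compactly_supported_bounded (@cpeta i) (test_function_compact (test_function_partial i etaP)).
have [C1 _ HC1] := compactly_supported_bounded ceta (test_function_compact etaP).
apply: L1_and_L2D.
  apply: L1_and_L2D.
    apply: L1_and_L2N; have [C2 _ HC2] := bd l.
    by apply: L1_and_L2_mul_bounded HC2 => //; exact: continuous_measurable_rV.
  apply: L1_and_L2N; under eq_fun do rewrite mulrC.
  by apply: L1_and_L2_mul_bounded HC1 => //; exact: continuous_measurable_rV.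
apply: L1_and_L2_sum => i; have [C2 _ HC2] := bd i.
by apply: L1_and_L2_mul_bounded HC2 => //; exact: continuous_measurable_rV.
Qed.

(* Only the factors coming from [u] are translated: integrated against a bump in [z],
   the flux becomes the conservation law for the mollified [u]. *)
Definition flux z : R :=
  \sum_l correlation (current l) (g l) z + correlation (fun x => a x * eta x) f z.

Lemma integrable_shift_mulL2 (p q : V -> R) z : L1_and_L2 p -> L1_and_L2 q ->
  mu.-integrable setT (EFin \o (fun x : V => p x * q (x + z))).
Proof.
move=> [mp p2 _] [mq q2 _].
apply: integrable_mulL2 => //; last exact: (integrable_rV_shift z q2).
exact: (measurableT_comp mq (measurable_rV_shift z)).
Qed.

Let a_eta_bounded : exists2 D : R, 0 <= D & forall x, `|a x * eta x| <= D.
Proof.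
have [C1 C10 HC1] := compactly_supported_bounded ceta (test_function_compact etaP).
have C0 : 0 <= C := le_trans (normr_ge0 _) (aC 0).
by exists (C * C1); [exact: mulr_ge0|move=> x; rewrite normrM ler_pM].
Qed.

Let aetai : mu.-integrable setT (EFin \o (fun x => a x * eta x)).
Proof. exact: (integrable_mul_test (L1_of aP) etaP). Qed.

Let maeta : measurable_fun setT (fun x => a x * eta x).
Proof. by apply/measurable_EFinP; apply: measurable_int; exact: aetai. Qed.

Let integrable_aeta_shift z :
  mu.-integrable setT (EFin \o (fun x : V => a x * eta x * f (x + z))).
Proof.
have [D _ HD] := a_eta_bounded.
have := integrable_mul_bounded (integrable_rV_shift z fi) maeta HD.
by apply: eq_integrable => // x _ /=; rewrite mulrC.
Qed.

Section bump.
Variable kappa : V -> R.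
Hypothesis sk : smooth kappa.
Hypothesis ck : compactly_supported kappa.
(** Makes [fun y => kappa (x - y)] a test function on the ball for each x with [eta x != 0], so that
    the weak equations for u can be used at x. *)
Hypothesis small : forall x y, eta x != 0 ->
  closure [set v | kappa v != 0] (x - y) -> U y.

Let v l := convolution (g l) kappa.
Let sv l : smooth (v l). Proof. by apply: smooth_convolution => //; exact: L1_of. Qed.
Let fk := convolution f kappa.

Let test_reflect x : eta x != 0 -> test_function (fun y => kappa (x - y)).
Proof. by move=> ex; apply: test_function_reflect => // y; exact: small. Qed.

Let test_reflect_partial i x : eta x != 0 -> test_function (fun y => partial i kappa (x - y)).
Proof.
move=> ex; apply: test_function_reflect; first exact: smooth_partial.
  exact: compactly_supported_partial.
move=> y; rewrite -[_ - y]/(x - y) => H; apply: (small ex); move: H.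
apply: closure_sub_closed; first exact: closed_closure.
by move=> z; exact: partial_support.
Qed.

Let pk i : smooth (partial i kappa) := smooth_partial i sk.

Let integrable_reflect i l x : eta x != 0 ->
  mu.-integrable setT (EFin \o (fun y => u y * - partial l (partial i kappa) (x - y))).
Proof.
move=> ex.
have := integrable_mul_test (L1_of uP) (test_function_partial l (test_reflect_partial i ex)).
by rewrite (partial_reflect l x (@pk i)).
Qed.

(** The derivative i falls on kappa, and the weak gradient is then tested against
    [partial i kappa (x - y)]; the sign of the weak derivative cancels that of the reflection. The
    right-hand side is visibly symmetric in i and l, and for i = l it sums to a Laplacian. *)
Lemma partial_mollified i l x : eta x != 0 ->
  partial i (v l) x = convolution u (partial l (partial i kappa)) x.
Proof.
move=> ex; rewrite /v (partial_convolution (L1_of (gP l)) i sk ck).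
have := ug l (test_reflect_partial i ex).
rewrite (partial_reflect l x (@pk i)) => /(congr1 -%R); rewrite opprK => E.
rewrite /convolution -E -[LHS]mulN1r.
rewrite -(RintegralZl _ measurableT (integrable_reflect i l ex)).
by apply: eq_Rintegral => y _; rewrite mulN1r mulrN opprK.
Qed.

Lemma curl_mollified i l x : eta x != 0 -> partial i (v l) x = partial l (v i) x.
Proof.
by move=> ex; rewrite (partial_mollified i l ex) (partial_mollified l i ex) (partialC i l sk).
Qed.

Lemma div_mollified x : eta x != 0 -> \sum_l partial l (v l) x = - fk x.
Proof.
move=> ex; rewrite (eq_bigr _ (fun l _ => partial_mollified l l ex)).
have := uf (test_reflect ex) => /(congr1 -%R); rewrite opprK => E.
rewrite /fk /convolution -E.
have il l : mu.-integrable setT (EFin \o (fun y => u y * partial l (partial l kappa) (x - y))).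
  have := integrableN (integrable_reflect l l ex).
  by apply: eq_integrable => // y _; rewrite /= mulrN opprK.
rewrite -(Rintegral_sum _ il).
rewrite (laplacian_reflect x sk).
by apply: eq_Rintegral => y _; rewrite /laplacian mulr_sumr.
Qed.

Lemma conservation_mollified :
  \sum_l \int[mu]_x (current l x * v l x) + \int[mu]_x (a x * eta x * fk x) = 0.
Proof.
(* The test form is eta times the gradient of the mollified u. *)
pose psi l x := eta x * v l x.
have tpsi l : test_function (psi l).
  apply: (test_function_support (smoothM seta (@sv l)) etaP).
  by move=> x; rewrite mulf_eq0 negb_or => /andP[ex _]; exact: subset_closure.
have dpsi i l x : partial i (psi l) x = eta x * partial i (v l) x + v l x * partial i eta x.
  exact: (deriveM (smooth_derivable seta) (smooth_derivable (@sv l))).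
have ia l : mu.-integrable setT (EFin \o (fun x => a x * partial l (psi l) x)).
  by apply: integrable_mul_test; [exact: L1_of|exact: test_function_partial].
have iw l : mu.-integrable setT (EFin \o (fun x => w l x * psi l x)).
  by apply: integrable_mul_test => //; exact: L1_of.
have ib i l : mu.-integrable setT (EFin \o (fun x => b i l x * partial i (psi l) x)).
  by apply: integrable_mul_test; [exact: L1_of|exact: test_function_partial].
have vb l := convolution_bounded (L1_of (gP l)) (smooth_continuous sk) ck.
have ic l : mu.-integrable setT (EFin \o (fun x => current l x * v l x)).
  have [D HD] := vb l.
  apply: (integrable_mul_bounded (L1_of (current_L1_and_L2 l)) (C := D)) => //.
  exact: continuous_measurable_rV (smooth_continuous (@sv l)).
have iaf : mu.-integrable setT (EFin \o (fun x => a x * eta x * fk x)).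
  have [D HD] := convolution_bounded fi (smooth_continuous sk) ck.
  apply: (integrable_mul_bounded (integrable_mul_test (L1_of aP) etaP) (C := D)) => //.
  exact: continuous_measurable_rV (smooth_continuous (smooth_convolution fi sk ck)).
have := dstar tpsi.
rewrite -Rintegral_sum // -(Rintegral_sum _ ic).
have iS1 := integrable_Rsum (index_enum 'I_n) ia.
have iS2 := integrable_Rsum (index_enum 'I_n) iw.
have iS3 := integrable_Rsum (index_enum 'I_n) (fun i => integrable_Rsum (index_enum 'I_n) (ib i)).
have iS4 := integrable_Rsum (index_enum 'I_n) ic.
move=> /eqP; rewrite -subr_eq0 opprK => /eqP E.
rewrite -RintegralD //.
have H (p q r s : R) : - p - q + r = 0 -> s + (p + q) = r -> s = 0.
  by move=> h1 h2; lra.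
have iS12 : mu.-integrable setT (EFin \o (fun x =>
    \sum_l a x * partial l (psi l) x + \sum_l w l x * psi l x)).
  exact: (integrableD measurableT iS1 iS2).
have iS45 : mu.-integrable setT (EFin \o (fun x =>
    \sum_l current l x * v l x + a x * eta x * fk x)).
  exact: (integrableD measurableT iS4 iaf).
apply: (H _ _ _ _ E).
rewrite -(RintegralD measurableT iS1 iS2) -(RintegralD measurableT iS45 iS12).
apply: eq_Rintegral => x _.
(* The divergence and symmetry identities for v are known only where eta does not vanish; multiplied
   by eta they hold everywhere. *)
have divx : eta x * (\sum_l partial l (v l) x) = - (eta x * fk x).
  have [->|ex] := eqVneq (eta x) 0; first by rewrite !mul0r oppr0.
  by rewrite (div_mollified ex) mulrN.
have curlx i l : eta x * partial i (v l) x = eta x * partial l (v i) x.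
  have [->|ex] := eqVneq (eta x) 0; first by rewrite !mul0r.
  by rewrite (curl_mollified i l ex).
have b0 : \sum_i \sum_l b i l x * (eta x * partial i (v l) x) = 0.
  set S := LHS; have S2 : S = - S.
    rewrite {1}/S exchange_big -sumrN; apply: eq_bigr => l _.
    by rewrite -sumrN; apply: eq_bigr => i _; rewrite bC curlx mulNr.
  lra.
under [X in _ + (X + _)]eq_bigr do rewrite dpsi mulrDr.
under [RHS]eq_bigr do under eq_bigr do rewrite dpsi mulrDr.
under [RHS]eq_bigr do rewrite big_split /=.
rewrite [RHS]big_split /= b0 add0r big_split /=.
have -> : \sum_l a x * (eta x * partial l (v l) x) = - (a x * (eta x * fk x)).
  by rewrite -mulr_sumr -mulr_sumr divx mulrN.
rewrite [RHS]exchange_big /=.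
have -> : \sum_l current l x * v l x =
    - (\sum_l a x * (v l x * partial l eta x)) - (\sum_l w l x * psi l x)
    + \sum_l \sum_i b i l x * (v l x * partial i eta x).
  rewrite -!sumrN -!big_split /=; apply: eq_bigr => l _.
  rewrite /current !mulrDl mulr_suml; congr (_ + _ + _); first by ring.
    by rewrite /psi; ring.
  by apply: eq_bigr => i _; ring.
ring.
Qed.

(** Reflected so that [rho (y - x)] is the convolution kernel [kappa (x - y)]. *)
Let rho z := kappa (- z).

Let mrho : measurable_fun setT rho.
Proof.
have := reflect_measurable 0 (smooth_continuous sk).
by rewrite /rho; under eq_fun do rewrite sub0r.
Qed.

Let rho_bounded : exists D : R, forall z, `|rho z| <= D.
Proof.
by have [D _ HD] := compactly_supported_bounded (smooth_continuous sk) ck; exists D => z; exact: HD.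
Qed.

Let convolutionE (h : V -> R) x : \int[mu]_y (h y * rho (y - x)) = convolution h kappa x.
Proof. by apply: eq_Rintegral => y _; rewrite /rho opprB. Qed.

Lemma integral_bump_flux :
  mu.-integrable setT (EFin \o (fun z => kappa (- z) * flux z)) /\
  \int[mu]_z (kappa (- z) * flux z) = 0.
Proof.
have [D HD] := rho_bounded.
have i1 l := integrable_correlation (L1_of (current_L1_and_L2 l)) (L1_of (gP l))
  mrho HD (fun z => integrable_shift_mulL2 z (current_L1_and_L2 l) (gP l)).
have i2 := integrable_correlation aetai fi mrho HD integrable_aeta_shift.
have e1 l := integral_correlation (L1_of (current_L1_and_L2 l)) (L1_of (gP l))
  mrho HD (fun z => integrable_shift_mulL2 z (current_L1_and_L2 l) (gP l)).
have e2 := integral_correlation aetai fi mrho HD integrable_aeta_shift.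
have i3 := integrable_Rsum (index_enum 'I_n) i1.
have E : (fun z => kappa (- z) * flux z) = (fun z =>
    \sum_l rho z * correlation (current l) (g l) z +
    rho z * correlation (fun x => a x * eta x) f z).
  by apply/funext => z; rewrite /flux mulrDr mulr_sumr.
rewrite E; split.
  exact: (integrableD measurableT i3 i2).
rewrite (RintegralD measurableT i3 i2) (Rintegral_sum _ i1) e2.
have E1 l : \int[mu]_z (rho z * correlation (current l) (g l) z) =
    \int[mu]_x (current l x * v l x).
  by rewrite e1; apply: eq_Rintegral => x _; rewrite convolutionE.
rewrite (eq_bigr _ (fun l _ => E1 l)).
under [X in _ + X]eq_Rintegral do rewrite convolutionE.
exact: conservation_mollified.
Qed.

End bump.

Lemma flux_cvg (z_ : nat -> V) : z_ @ \oo --> (0 : V) ->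
  (fun k => flux (z_ k)) @ \oo --> flux 0.
Proof.
move=> z0.
have tc (h : V -> R) : mu.-integrable setT (EFin \o h) -> (forall x, ~ U x -> h x = 0) ->
    L1_translation_continuous z_ h.
  by move=> hi h0; apply: (L1_translation_continuous_supp z0 open_unit_ball unit_ball_finite_measure).
have [D _ HD] := a_eta_bounded.
have c2 := correlation_cvg_bounded maeta HD (tc f fi f0).
have c1 l : (fun k => correlation (current l) (g l) (z_ k)) @ \oo -->
    correlation (current l) (g l) 0.
  have [mc c2' ci] := current_L1_and_L2 l; have [mg g2 gi] := gP l.
  exact: (correlation_cvg_L2 mc c2' (tc (g l) gi (@g0 l)) g2).
have c3 : (fun k => \sum_l correlation (current l) (g l) (z_ k)) @ \oo -->
    \sum_l correlation (current l) (g l) 0.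
  elim: (index_enum 'I_n) => [|l s IH].
    under eq_fun do rewrite big_nil; rewrite big_nil; exact: cvg_cst.
  under eq_fun do rewrite big_cons; rewrite big_cons; exact: (cvgD (c1 l) IH).
exact: (cvgD c3 c2).
Qed.

Lemma flux0_eq0 : flux 0 = 0.
Proof.
(* The case eta = 0 is apart because the bumps below are made from eta and must not vanish
   identically. *)
have [eta0|/existsNP[w0 /eqP w0P]] := pselect (forall x, eta x = 0).
  have E : eta = cst 0 by apply/funext.
  have pe i x : partial i eta x = 0 by rewrite E; exact: derive_cst.
  have z0 : \int[mu]_(x in [set: V]) (0 : R) = 0 by rewrite /Rintegral integral0.
  rewrite /flux big1 => [|l _]; last first.
    rewrite -[RHS]z0; apply: eq_Rintegral => x _.
    have S0 : \sum_i b i l x * partial i eta x = 0 by apply: big1 => i _; rewrite pe mulr0.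
    by rewrite /current S0 pe eta0; ring.
  by rewrite add0r -[RHS]z0; apply: eq_Rintegral => x _; rewrite eta0 mulr0 mul0r.
have [_ cK KU] := etaP.
have [d d0 dU] := compact_sub_open cK open_unit_ball KU.
have [N _ /(_ N (leqnn N)) dN] := near_infty_natSinv_lt (PosNum d0).
(* The offset N makes 1 / c k smaller than d for every k, where d bounds from below how far the
   support of eta can be moved inside the ball. *)
pose c k : R := (k + N).+1%:R.
have c0 k : 0 < c k by rewrite ltr0n.
(* The square gives nonnegativity. As eta lives in the unit ball, the support lies in the cube of
   half-side 1 / c k. The summand 0 fits the shape of [smooth_affine]. *)
pose kappa k (t : V) : R := eta (c k *: t + 0) * eta (c k *: t + 0).
have sk k : smooth (kappa k).
  by apply: smoothM; apply: smooth_affine => //; rewrite gt_eqF.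
have supp k t : kappa k t != 0 -> forall i, `|t ord0 i| <= (c k)^-1.
  rewrite mulf_eq0 orbb addr0 => ew i.
  have Ucw : U (c k *: t) by apply: KU; exact: subset_closure.
  have := unit_ball_coord i Ucw; rewrite mxE normrM gtr0_norm // => h.
  by rewrite -(ler_pM2l (c0 k)) mulfV ?gt_eqF // ltW.
have ck k : compactly_supported (kappa k).
  apply: (support_sub_compact (@compact_cube R n (c k)^-1)).
    by apply: compact_closed; [exact: norm_hausdorff|exact: compact_cube].
  by move=> t; exact: supp.
have cN k : (c k)^-1 <= N.+1%:R^-1.
  by rewrite lef_pV2 ?posrE ?ltr0n // ler_nat ltnS leq_addl.
have small k x y : eta x != 0 -> closure [set v | kappa k v != 0] (x - y) -> U y.
  move=> ex xy; apply: (dU x); first exact: subset_closure.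
  have /= : [set t : V | forall i, `|t ord0 i| <= (c k)^-1] (x - y).
    move: xy; apply: closure_sub_closed; last by move=> t; exact: supp.
    by apply: compact_closed; [exact: norm_hausdorff|exact: compact_cube].
  move=> h i; have := h i; rewrite !mxE distrC => /le_trans; apply.
  by apply: (le_trans (cN k)); exact: ltW.
have crho k : continuous (fun z : V => kappa k (- z)).
  have N1 : (-1 : R) != 0 by rewrite oppr_eq0 oner_eq0.
  have -> : (fun z : V => kappa k (- z)) = (fun z => kappa k ((-1) *: z + 0)).
    by apply/funext => z; rewrite scaleN1r addr0.
  exact: smooth_continuous (smooth_affine 0 N1 (sk k)).
(* Used for s = 1 and s = -1. For each k a point z of the k-th reflected bump has s * flux z <= 0;
   these points tend to 0, and [flux_cvg] passes to the limit. *)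
have main (s : R) : s * flux 0 <= 0.
  have ex k : exists z : V, (forall i, `|z ord0 i| <= (c k)^-1) /\ s * flux z <= 0.
    have [iF I0] := integral_bump_flux (sk k) (ck k) (small k).
    have E : (fun z : V => kappa k (- z) * (s * flux z)) = (fun z : V => s * (kappa k (- z) * flux z)).
      by apply/funext => z; rewrite mulrCA.
    have [||||z kz sz] := @exists_le0_of_integral0 _ _ (fun z : V => kappa k (- z)) (fun z => s * flux z) (crho k).
    - by move=> z; exact: sqr_ge0.
    - exists (- ((c k)^-1 *: w0)).
      by rewrite opprK /kappa addr0 scalerA mulfV ?scale1r ?mulf_eq0 ?orbb // gt_eqF.
    - by rewrite E; apply: (eq_integrable _ (fun z : V => s%:E * (kappa k (- z)%R * flux z)%R%:E)%E) => //; exact: integrableZl.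
    - by rewrite E RintegralZl // I0 mulr0.
    exists z; split => // i.
    by have := supp _ _ kz i; rewrite mxE normrN.
  have [z_ zP] := choice ex.
  have z0 : z_ @ \oo --> (0 : V).
    apply/cvg_ballP => e e0.
    have [M _ HM] := near_infty_natSinv_lt (PosNum e0).
    exists M => // k /= Mk; split => // r i; rewrite ord1 /ball/= mxE sub0r normrN.
    apply: (le_lt_trans ((zP k).1 i)); apply: le_lt_trans (HM k Mk).
    by rewrite lef_pV2 ?posrE ?ltr0n // ler_nat ltnS leq_addr.
  have := flux_cvg z0 => /(cvgMl_tmp (a := s)) h.
  have : \forall k \near \oo, s * flux (z_ k) <= 0 by apply: nearW => k; exact: (zP k).2.
  by apply: (cvgr_to_le h).
apply/eqP; rewrite eq_le; have := main 1; have := main (-1).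
by rewrite mulN1r mul1r oppr_le0 => -> ->.
Qed.

End conservation.

(** * From forms to components *)

Section reduction.
Context {R : realType} {n : nat}.
Local Notation V := 'rV[R]_n.
Local Notation mu := (lebesgue_rV n : {sigma_finite_measure set V -> \bar R}).
Local Notation U := (@unit_ball R n).
Implicit Types (p q f g : V -> R) (x y : V).

Lemma ball_integral_mul p q :
  ball_integral (fun x => p x * q x) = \int[mu]_x ((p \_ U) x * q x).
Proof.
rewrite ball_integralE; apply: eq_Rintegral => x _; rewrite !ball_restrictE.
by case: ifP => // _; rewrite mul0r.
Qed.

Lemma ball_restrict_out p x : ~ U x -> (p \_ U) x = 0.
Proof. by move=> nUx; rewrite ball_restrictE memNset. Qed.

Lemma ball_restrict_in p x : U x -> (p \_ U) x = p x.
Proof. by move=> Ux; rewrite ball_restrictE mem_set. Qed.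

Lemma L1_and_L2_indic : L1_and_L2 (\1_U : V -> R).
Proof.
have mU : measurable U by exact: open_measurable_rV open_unit_ball.
split => //; last exact: integrable_indic_unit_ball.
apply: eq_integrable integrable_indic_unit_ball => // x _ /=.
by rewrite indicE; case: (x \in U); rewrite ?expr1n // expr0n.
Qed.

(** An entry of A is bounded only almost everywhere, whereas the estimates ask for a bound at every
    point; the values exceeding the essential bound are replaced by 0. *)
Lemma Linfty_representative f : in_Linfty f ->
  exists (p : V -> R) (C : R), [/\ L1_and_L2 p, forall x, `|p x| <= C,
    measurable_fun setT (f \_ U) & {ae mu, forall x, (f \_ U) x = p x}].
Proof.
move=> /andP[]; rewrite !inE /= => mf; rewrite /finite_norm unlock.
move=> H; have [C HC] : exists C : R, {ae mu, forall x, `|(f \_ U) x| <= C}.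
  (* If the whole space were null the norm would carry no information, but then any bound holds
     almost everywhere. *)
  move: H; case: ifPn => [_ /ess_supr_bounded //|m0 _].
  exists 0; exists setT; split => //; apply/eqP.
  by rewrite -measure_le0 leNgt.
pose p x := if `|(f \_ U) x| <= C then (f \_ U) x else 0.
have mp : measurable_fun setT p.
  apply: measurable_fun_ifT => //; apply: measurable_fun_ler => //.
  exact: measurableT_comp.
have pC x : `|p x| <= `|C|.
  by rewrite /p; case: ifP => [h|_]; [exact: le_trans h (ler_norm _)|rewrite normr0].
exists p, `|C|; split => //.
- have := L1_and_L2_mul_bounded L1_and_L2_indic mp pC.
  rewrite (_ : (fun x => _) = p) //; apply/funext => x; rewrite indicE.
  have [Ux|nUx] := pselect (U x); first by rewrite mem_set // mul1r.
  by rewrite memNset // mul0r /p ball_restrict_out // if_same.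
- by apply: filterS HC => x hx; rewrite /p hx.
Qed.

Lemma test_function0 : test_function (fun _ : V => 0 : R).
Proof.
have E : [set x : V | (0 : R) != 0] = set0 by apply/seteqP; split => x //=; rewrite eqxx.
split; first exact: smooth_cst.
  by rewrite E closure0; exact: compact0.
by rewrite E closure0.
Qed.

Lemma in_L2_W12 f : in_W12 f -> in_L2 f.
Proof. by case. Qed.

Lemma weak_partialP f l : in_W12 f ->
  in_L2 (weak_partial l f) /\ is_weak_partial l f (weak_partial l f).
Proof. by move=> [_ /(_ l)] fl; exact: (xgetPex _ fl). Qed.

Definition one_form (psi : 'I_n -> V -> R) x : extalg R n := \sum_l psi l x *: dx l.

Lemma one_formE psi x l : one_form psi x [set l]%SET = psi l x.
Proof.
rewrite /one_form sum_ffunE (bigD1 l) //= big1 ?addr0 => [|k kl].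
  by rewrite !ffunE eqxx [LHS]mulr1.
rewrite !ffunE (inj_eq (@finset.set1_inj _)) eq_sym (negPf kl).
by rewrite [LHS]mulr0.
Qed.

Lemma one_form_out psi x (I : {set 'I_n}) : (forall l, I != [set l]%SET) ->
  one_form psi x I = 0.
Proof.
move=> Il; rewrite /one_form sum_ffunE big1 // => k _.
by rewrite !ffunE (negPf (Il k)) [LHS]mulr0.
Qed.

Lemma test_form_one_form psi : (forall l, test_function (psi l)) ->
  test_form (one_form psi).
Proof.
move=> tpsi I; have [/existsP[l /eqP ->]|] := boolP [exists l, I == [set l]%SET].
  by under eq_fun do rewrite one_formE; exact: tpsi.
rewrite negb_exists => /forallP Il.
by under eq_fun do rewrite one_form_out //; exact: test_function0.
Qed.

Lemma form_partial_one_form psi i x :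
  form_partial i (one_form psi) x = one_form (fun l => partial i (psi l)) x.
Proof.
apply/ffunP => I; rewrite ffunE.
have [/existsP[l /eqP ->]|] := boolP [exists l, I == [set l]%SET].
  by rewrite one_formE; congr partial; apply/funext => y; rewrite one_formE.
rewrite negb_exists => /forallP Il; rewrite one_form_out //.
rewrite (_ : (fun y => _) = cst 0); first exact: derive_cst.
by apply/funext => y; rewrite one_form_out.
Qed.

Lemma eq_Rintegral_ae p q : measurable_fun setT p -> measurable_fun setT q ->
  {ae mu, forall x, p x = q x} -> \int[mu]_x p x = \int[mu]_x q x.
Proof.
move=> mp mq pq; rewrite /Rintegral; congr fine.
apply: ae_eq_integral => //; [exact/measurable_EFinP|exact/measurable_EFinP|].
by apply: filterS pq => x /= -> _.
Qed.


Lemma distr_d_form0 p psi : distr_d (fun x => form0 (p x)) (one_form psi) =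
  - \sum_l \int[mu]_x ((p \_ U) x * partial l (psi l) x).
Proof.
congr (- _); apply: eq_bigr => l _; rewrite -ball_integral_mul.
apply: eq_Rintegral => x _.
by rewrite wedge_dx_form0 dotC dotZr dot_dxr form_partial_one_form one_formE.
Qed.

Lemma distr_one_form (omega : V -> extalg R n) psi : distr omega (one_form psi) =
  \int[mu]_x (\sum_l ((fun y => omega y [set l]%SET) \_ U) x * psi l x).
Proof.
rewrite /distr ball_integralE; apply: eq_Rintegral => x _.
rewrite ball_restrictE; case: ifPn => xU.
  rewrite /one_form dot_sumr; apply: eq_bigr => l _.
  by rewrite dot_dxr ball_restrictE xU mulrC.
by rewrite big1 // => l _; rewrite ball_restrictE (negPf xU) mul0r.
Qed.

(** Pairing with dx_i /\ dx_l, instead of reading B at the set of i and l, gives a family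
    antisymmetric in all i and l, whatever their order. *)
Definition wedge_coef (B : V -> extalg R n) i l x : R := dot (B x) (wedge (dx i) (dx l)).

Lemma distr_dstar_one_form (B : V -> extalg R n) psi : distr_dstar B (one_form psi) =
  \int[mu]_x (\sum_i \sum_l (wedge_coef B i l \_ U) x * partial i (psi l) x).
Proof.
rewrite /distr_dstar /distr ball_integralE; apply: eq_Rintegral => x _.
rewrite ball_restrictE; case: ifPn => xU; last first.
  by rewrite big1 // => i _; rewrite big1 // => l _; rewrite ball_restrictE (negPf xU) mul0r.
rewrite /extd -(eq_bigr _ (fun i _ => scale1r _)) (dot_sumr _ (fun=> 1)).
apply: eq_bigr => i _; rewrite mul1r form_partial_one_form /one_form wedge_sumr dot_sumr.
by apply: eq_bigr => l _; rewrite ball_restrictE xU mulrC.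
Qed.

Lemma wedge_coefC B i l x : wedge_coef B i l x = - wedge_coef B l i x.
Proof. by rewrite /wedge_coef wedge_dxC dotNr. Qed.

(** The factor (-1)^(n-1) of the conservation law meets the (-1)^n of [wedge_dx_wedge_hodge] and
    leaves -1 in every dimension. The wedge has top degree, so only the top coefficient of b is
    seen. *)
Lemma dot_wedge_current i m (a : 'I_m -> R) (B : 'I_m -> extalg R n)
    (g : 'I_m -> 'I_n -> R) (b : extalg R n) : (0 < n)%N ->
  (forall j, homogeneous 2 (B j)) ->
  dot (wedge (dx i) (\sum_j (a j *: hodge (\sum_l g j l *: dx l) +
    (-1) ^+ n.-1 *: wedge (hodge (B j)) (\sum_l g j l *: dx l)))) b =
  (\sum_j (a j * g j i - \sum_l dot (B j) (wedge (dx i) (dx l)) * g j l)) * b [set: 'I_n]%SET.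
Proof.
move=> n0 hB.
rewrite -(eq_bigr _ (fun j _ => scale1r _)) (wedge_sumr _ (fun=> 1)) dotC.
rewrite (dot_sumr _ (fun=> 1)) mulr_suml; apply: eq_bigr => j _; rewrite mul1r.
have -> : wedge (dx i) (a j *: hodge (\sum_l g j l *: dx l) +
    (-1) ^+ n.-1 *: wedge (hodge (B j)) (\sum_l g j l *: dx l)) =
  (a j * g j i - \sum_l dot (B j) (wedge (dx i) (dx l)) * g j l) *: hodge (form0 1).
  rewrite wedgeDr !wedgeZr hodge_sum !wedge_sumr scalerBl; congr (_ + _).
    rewrite -scalerA; congr (_ *: _).
    rewrite (bigD1 i) //= big1 ?addr0 => [|l li]; last first.
      by rewrite wedge_dx_hodge_dx eq_sym (negPf li) scale0r scaler0.
    by rewrite wedge_dx_hodge_dx eqxx scale1r.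
  rewrite scaler_suml -sumrN scaler_sumr; apply: eq_bigr => l _.
  rewrite wedge_dx_wedge_hodge // !scalerA -scaleNr; congr (_ *: _).
  have sgn : (-1) ^+ n.-1 * (-1) ^+ n = -1 :> R.
    rewrite -[in X in _ * X](prednK n0) exprS mulrCA -expr2 sqrr_sign mulr1.
    by [].
  by rewrite mulrACA sgn mulN1r [in LHS]mulrC.
by rewrite dotZr dotC dot_volume_form.
Qed.

End reduction.

(** * Summation over the components *)

Theorem theorem3 (R : realType) (n m : nat) (n_gt0 : (0 < n)%N)
    (Omega : 'rV[R]_n -> 'M[extalg R n]_m)
    (A : 'rV[R]_n -> 'M[R]_m)
    (B : 'rV[R]_n -> 'M[extalg R n]_m)
    (u : 'rV[R]_n -> 'rV[R]_m)
    (Omega_L2 : forall i j, in_L2_form 1%N (fun x => Omega x i j))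
    (Omega_so : forall x, unit_ball x -> forall i j, Omega x i j = - Omega x j i)
    (A_Linfty : forall i j, in_Linfty (fun x => A x i j))
    (A_W12 : forall i j, in_W12 (fun x => A x i j))
    (B_W12 : forall i j, in_W12_form 2%N (fun x => B x i j))
    (dOmegaA : forall i j psi, test_form psi ->
      distr_d (fun x => form0 (A x i j)) psi
        - distr (fun x => \sum_k A x i k *: Omega x k j) psi
      = - distr_dstar (fun x => B x i j) psi)
    (u_W12 : forall i, in_W12 (fun x => u x ord0 i))
    (u_eq : forall i phi, test_function phi ->
      - distr_laplacian (fun x => u x ord0 i) phi
      = ball_integral (fun x =>
          (\sum_j dot (Omega x i j)
                      (weak_differential (fun y => u y ord0 j) x)) * phi x)) :
  forall i psi, test_form psi ->
    distr_d (fun x => \sum_j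
      let du_j := weak_differential (fun y => u y ord0 j) x in
      (A x i j *: hodge du_j
       + (-1) ^+ n.-1 *: wedge (hodge (B x i j)) du_j)) psi = 0.
Proof.
move=> i0 psi tpsi.
pose V := 'rV[R]_n.
pose mu := (lebesgue_rV n : {sigma_finite_measure set V -> \bar R}).
pose U := @unit_ball R n.
have [a Ha] := choice (fun j => Linfty_representative (A_Linfty i0 j)).
have {Ha} [C aP] := choice Ha.
have ae_a : {ae mu, forall x, forall j, ((fun x => A x i0 j) \_ U) x = a j x}.
  by apply: filter_forall => j; have [_ _ _] := aP j.
pose v j : V -> R := (fun x => u x ord0 j) \_ U.
pose g j l : V -> R := weak_partial l (fun y => u y ord0 j) \_ U.
pose om j k l : V -> R := (fun x => Omega x j k [set l]%SET) \_ U.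
pose f j x := \sum_k \sum_l om j k l x * g k l x.
pose w j l x := \sum_k om k j l x * a k x.
pose b j i l : V -> R := wedge_coef (fun x => B x i0 j) i l \_ U.
have vP j : L1_and_L2 (v j) by apply: in_L2P; exact: in_L2_W12.
have gP j l : L1_and_L2 (g j l).
  by apply: in_L2P; have [] := weak_partialP l (u_W12 j).
have omP j k l : L1_and_L2 (om j k l).
  by apply: in_L2P; have [_] := Omega_L2 j k; exact.
have bP j i l : L1_and_L2 (b j i l).
  rewrite (_ : b j i l = (fun x => \sum_(I : {set 'I_n}) ((fun y => B y i0 j I) \_ U) x * wedge (dx i) (dx l) I)).
    apply: L1_and_L2_sum => I; apply: (L1_and_L2_mul_bounded (C := `|wedge (dx i) (dx l) I|)) => //.
    by apply: in_L2P; apply: in_L2_W12; have [_] := B_W12 i0 j; exact.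
  apply/funext => x; rewrite /b /wedge_coef /dot ball_restrictE; case: ifPn => xU.
    by apply: eq_bigr => I _; rewrite ball_restrictE xU.
  by rewrite big1 // => I _; rewrite ball_restrictE (negPf xU) mul0r.
have wP j l : L1_and_L2 (w j l).
  apply: L1_and_L2_sum => k; have [[mk _ _] Ck _ _] := aP k.
  exact: (L1_and_L2_mul_bounded (omP k j l) mk Ck).
have int_mul p q : L1_and_L2 p -> L1_and_L2 q -> mu.-integrable setT (EFin \o (fun x => p x * q x)).
  by move=> [mp p2 _] [mq q2 _]; exact: integrable_mulL2.
have fi j : mu.-integrable setT (EFin \o f j).
  by apply: integrable_Rsum => k; apply: integrable_Rsum => l; exact: int_mul.
have bC j i l x : b j i l x = - b j l i x.
  rewrite /b !ball_restrictE; case: ifP => _; last by rewrite oppr0.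
  exact: wedge_coefC.
have g0 j l x : ~ U x -> g j l x = 0 by exact: ball_restrict_out.
have f0 j x : ~ U x -> f j x = 0.
  by move=> nUx; rewrite /f big1 // => k _; rewrite big1 // => l _; rewrite g0 // mulr0.
have ug j l phi : test_function phi ->
    \int[mu]_x (v j x * partial l phi x) = - (\int[mu]_x (g j l x * phi x)).
  move=> tphi; have [_ /(_ phi tphi)] := weak_partialP l (u_W12 j).
  by rewrite !ball_integral_mul.
have dotOm j k x : U x -> dot (Omega x j k) (weak_differential (fun y => u y ord0 k) x) =
    \sum_l om j k l x * g k l x.
  move=> Ux; rewrite /weak_differential dot_sumr; apply: eq_bigr => l _.
  by rewrite dot_dxr /om /g !ball_restrict_in // mulrC.
have uf j phi : test_function phi ->
    - (\int[mu]_x (v j x * laplacian phi x)) = \int[mu]_x (f j x * phi x).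
  move=> tphi; have := u_eq j phi tphi; rewrite /distr_laplacian !ball_integral_mul => ->.
  apply: eq_Rintegral => x _; congr (_ * _).
  have [Ux|nUx] := pselect (U x); last by rewrite f0 // ball_restrict_out.
  by rewrite ball_restrict_in //; apply: eq_bigr => k _; exact: dotOm.
have eq_mul (p q r s : R) : p = q -> r = s -> p * r = q * s by move=> -> ->.
have eq_sub (p q r s : R) : p = q -> r = s -> p - r = q - s by move=> -> ->.
have eq_add (p q r s : R) : p = q -> r = s -> p + r = q + s by move=> -> ->.
have mA j : measurable_fun setT ((fun x => A x i0 j) \_ U) by have [_ _] := aP j.
have ma j : measurable_fun setT (a j) by have [[]] := aP j.
have mtest (phi : V -> R) : test_function phi -> measurable_fun setT phi.
  by move=> /test_function_continuous; exact: continuous_measurable_rV.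
have dstar j (chi : 'I_n -> V -> R) : (forall l, test_function (chi l)) ->
    - (\sum_l \int[mu]_x (a j x * partial l (chi l) x))
      - (\int[mu]_x (\sum_l w j l x * chi l x))
    = - (\int[mu]_x (\sum_i \sum_l b j i l x * partial i (chi l) x)).
  move=> tchi; have := dOmegaA i0 j _ (test_form_one_form tchi).
  rewrite distr_d_form0 distr_one_form distr_dstar_one_form => <-.
  (* The equation is known for A and wanted for its bounded representative a; both sides are
     integrals, so agreement almost everywhere is enough. *)
  congr (- _ - _).
    apply: eq_bigr => l _; apply: eq_Rintegral_ae.
    - by apply: measurable_funM => //; exact: mtest (test_function_partial l (tchi l)).
    - by apply: measurable_funM => //; exact: mtest (test_function_partial l (tchi l)).
    - by apply: filterS ae_a => x ->.
  have E x l : ((fun y => (\sum_k A y i0 k *: Omega y k j) [set l]%SET) \_ U) x =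
      \sum_k om k j l x * ((fun x => A x i0 k) \_ U) x.
    rewrite ball_restrictE; case: ifPn => xU.
      rewrite sum_ffunE; apply: eq_bigr => k _; rewrite ffunE /om !ball_restrictE xU.
      exact: mulrC.
    by rewrite big1 // => k _; rewrite ball_restrictE (negPf xU) mulr0.
  under [RHS]eq_Rintegral do under eq_bigr do rewrite E.
  have mom k l : measurable_fun setT (om k j l) by have [] := omP k j l.
  apply: eq_Rintegral_ae.
  - by apply: measurable_sum => l; apply: measurable_funM; [have [] := wP j l|exact: mtest].
  - apply: measurable_sum => l; apply: measurable_funM; last exact: mtest.
    by apply: measurable_sum => k; exact: measurable_funM.
  - apply: filterS ae_a => x ax; apply: eq_bigr => l _; congr (_ * _).
    by apply: eq_bigr => k _; rewrite ax.
(* The scalar test function is the volume coefficient of psi. *)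
pose eta x := psi x [set: 'I_n]%SET.
have teta : test_function eta by exact: tpsi.
have flux0 j : flux (a j) (f j) (w j) (g j) (b j) eta 0 = 0.
  have [aj aC _ _] := aP j.
  exact: (flux0_eq0 aj aC (wP j) (bP j) (bC j) (gP j) (g0 j) (vP j) (fi j) (f0 j) (ug j) (uf j) (@dstar j) teta).
pose P i x := (\sum_j (a j x * g j i x - \sum_l b j i l x * g j l x)) * partial i eta x.
transitivity (- \sum_i \int[mu]_x P i x).
  congr (- _); apply: eq_bigr => i _.
  (* Intermediate integrand that still carries A: the algebra of forms is pointwise, while the
     change from A to a is only almost everywhere. *)
  pose PA x := (\sum_j (((fun x => A x i0 j) \_ U) x * g j i x - \sum_l b j i l x * g j l x)) * partial i eta x.
  transitivity (\int[mu]_x PA x).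
    rewrite ball_integralE; apply: eq_Rintegral => x _; rewrite /PA.
    have [Ux|nUx] := pselect (U x); last first.
      rewrite ball_restrict_out // big1 ?mul0r // => j _.
      by rewrite ball_restrict_out // mul0r big1 ?subr0 // => l _; rewrite g0 // mulr0.
    rewrite ball_restrict_in //= /weak_differential dot_wedge_current //; last first.
      by move=> j; have [h _] := B_W12 i0 j; exact: h.
    rewrite [form_partial i psi x _]ffunE; apply: (eq_mul); last by [].
    have gE j l : weak_partial l (fun y => u y ord0 j) x = g j l x.
      exact: esym (ball_restrict_in _ Ux).
    have bE j l : dot (B x i0 j) (wedge (dx i) (dx l)) = b j i l x.
      exact: esym (ball_restrict_in _ Ux).
    apply: eq_bigr => j _; apply: (eq_sub).
      by apply: (eq_mul); [exact: esym (ball_restrict_in _ Ux)|exact: gE].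
    by apply: eq_bigr => l _; apply: (eq_mul); [exact: bE|exact: gE].
  have mg j l : measurable_fun setT (g j l) by have [] := gP j l.
  have mP (c : 'I_m -> V -> R) : (forall j, measurable_fun setT (c j)) ->
      measurable_fun setT (fun x => (\sum_j (c j x * g j i x - \sum_l b j i l x * g j l x)) * partial i eta x).
    move=> mc; apply: measurable_funM; last exact: mtest (test_function_partial i teta).
    apply: measurable_sum => j; apply: measurable_funB; first exact: measurable_funM.
    by apply: measurable_sum => l; apply: measurable_funM => //; have [] := bP j i l.
  apply: eq_Rintegral_ae; [exact: mP|exact: mP|].
  apply: filterS ae_a => x ax; rewrite /PA /P; apply: (eq_mul); last by [].
  by apply: eq_bigr => j _; rewrite ax.
have cP j l : L1_and_L2 (current (a j) (w j) (b j) eta l).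
  by have [aj _ _ _] := aP j; exact: (current_L1_and_L2 aj (wP j) (bP j) teta).
have icg j l : mu.-integrable setT (EFin \o (fun x => current (a j) (w j) (b j) eta l x * g j l x)).
  exact: int_mul.
have iaf j : mu.-integrable setT (EFin \o (fun x => a j x * eta x * f j x)).
  have [_ aC _ _] := aP j.
  have := integrable_mul_test (integrable_mul_bounded (fi j) (ma j) aC) teta.
  by apply: eq_integrable => // x _ /=; congr EFin; ring.
have icgs j := integrable_Rsum (index_enum 'I_n) (icg j).
(* The integrand of the j-th flux at z = 0; its integral vanishes for each j, but only the sum over
   j is the conservation law. *)
pose Q j x := \sum_l current (a j) (w j) (b j) eta l x * g j l x + a j x * eta x * f j x.
have iQ j : mu.-integrable setT (EFin \o Q j) := integrableD measurableT (icgs j) (iaf j).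
have Q0 j : \int[mu]_x Q j x = 0.
  rewrite -[RHS](flux0 j) /flux /Q (RintegralD measurableT (icgs j) (iaf j)).
  rewrite (Rintegral_sum _ (icg j)); apply: (eq_add).
    by apply: eq_bigr => l _; apply: eq_Rintegral => x _; rewrite addr0.
  by apply: eq_Rintegral => x _; rewrite addr0.
have iP i : mu.-integrable setT (EFin \o P i).
  apply: (integrable_mul_test _ (test_function_partial i teta)).
  apply: integrable_Rsum => j; have [aj _ _ _] := aP j.
  exact: (integrableB measurableT (int_mul _ _ aj (gP j i))
    (integrable_Rsum _ (fun l => int_mul _ _ (bP j i l) (gP j l)))).
apply/eqP; rewrite oppr_eq0 -(Rintegral_sum _ iP) -oppr_eq0; apply/eqP.
transitivity (\int[mu]_x \sum_j Q j x); last by rewrite (Rintegral_sum _ iQ) big1.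
rewrite -mulN1r -(RintegralZl _ measurableT (integrable_Rsum _ iP)).
apply: eq_Rintegral => x _; rewrite mulN1r.
have T1 : \sum_i P i x = \sum_j \sum_l a j x * g j l x * partial l eta x -
   \sum_j \sum_l \sum_i b j i l x * partial i eta x * g j l x.
  rewrite /P; under eq_bigr do rewrite mulr_suml.
  rewrite exchange_big /= -sumrB; apply: eq_bigr => j _.
  rewrite [X in _ - X]exchange_big /= -sumrB; apply: eq_bigr => i _.
  rewrite mulrBl mulr_suml; apply: (eq_sub); first by [].
  by apply: eq_bigr => l _; ring.
(* The cancellation of the extra terms: both sides are one double sum of a_k Omega^k_j . du^j, with
   the names of the two indices exchanged. *)
have T2 : \sum_j \sum_l eta x * w j l x * g j l x = \sum_j a j x * eta x * f j x.
  rewrite /w /f; under eq_bigr do under eq_bigr do rewrite mulr_sumr mulr_suml.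
  under [RHS]eq_bigr do rewrite mulr_sumr.
  rewrite [RHS]exchange_big /=; apply: eq_bigr => j _.
  rewrite exchange_big /=; apply: eq_bigr => k _.
  by rewrite mulr_sumr; apply: eq_bigr => l _; ring.
(* The summand [e * q * r], provided by [T2], removes the contribution of w to the current. *)
have alg (p q r s t e : R) :
    s * r - p * r * t = (- (p * t) - e * q + s) * r + e * q * r by ring.
have sumE k (F1 F2 F3 F4 : 'I_k -> R) : (forall l, F1 l - F2 l = F3 l + F4 l) ->
    \sum_l F1 l - \sum_l F2 l = \sum_l F3 l + \sum_l F4 l.
  by move=> F; rewrite -sumrB -big_split; exact: eq_bigr.
rewrite T1 /Q big_split /= -T2 opprB.
apply: (sumE) => j; apply: (sumE) => l.
rewrite -mulr_suml.
exact: alg.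
Qed.
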